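(* Given any instance $\mathcal I=(\mathcal K,\mathcal Q,\mathcal C,\alpha,\beta)$ of the two-way-comparison search tree problem with $n=|\mathcal K|$ keys that admits a correct two-way-comparison search tree, one can compute, in $O(n\log n)$ time, a correct two-way-comparison search tree whose cost is at most the optimum cost plus $3$.
   Context: An instance is a tuple $\mathcal I=(\mathcal K,\mathcal Q,\mathcal C,\alpha,\beta)$ where $\mathcal K=\{K_1<K_2<\dots<K_n\}$ is a set of real keys, $\mathcal Q\subseteq\mathbb R$ is the set of possible queries, $\mathcal C\subseteq\{<,\le,=,\ge,>\}$ is the set of allowed comparison operators, and a probability distribution on $\mathcal Q$ is given by $\beta_i=\Pr[v=K_i]$ and $\alpha_i=\Pr[K_i<v<K_{i+1}]$ (with $\alpha_0=\Pr[v<K_1]$, $\alpha_n=\Pr[v>K_n]$) for a random query $v$. A two-way-comparison search tree is a rooted binary tree whose internal nodes are each labeled by a comparison ''$v\ \mathrm{op}\ K_i$'' with $\mathrm{op}\in\mathcal C$, $K_i\in\mathcal K$, with a ''yes'' and a ''no'' child; a query is routed from the root according to the outcomes until a leaf is reached. The tree is correct if, for every leaf, all queries in $\mathcal Q$ reaching it have the same relation ($<$, $=$, $>$) to every key in $\mathcal K$. Its cost is the expected number of comparisons made on a random query; the optimum cost is the minimum cost of a correct tree. *)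

(* Defs.v *)
From mathcomp Require Export all_boot all_order all_algebra.
From mathcomp Require Export boolp classical_sets reals.

Set Implicit Arguments.
Unset Strict Implicit.
Unset Printing Implicit Defensive.

Import Order.TTheory GRing.Theory Num.Theory.
Local Open Scope ring_scope.

Inductive cmp_op := OpLt | OpLe | OpEq | OpGe | OpGt.

(* The answer to "v op K", given the relation of v to K. *)
Definition cmp_holds (op : cmp_op) (c : comparison) : bool :=
  match op, c with
  | OpLt, Lt | OpLe, Lt | OpLe, Eq | OpEq, Eq
  | OpGe, Eq | OpGe, Gt | OpGt, Gt => true
  | _, _ => false
  end.

Definition compare_real (R : realType) (x y : R) : comparison :=
  if x < y then Lt else if x == y then Eq else Gt.

(* Keys are numbered from 0, so [key i] is K_{i+1}, [beta i] is beta_{i+1},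
   and gap [j] (0 <= j <= n), with probability [alpha j], is the open interval
   between K_j and K_{j+1}, where K_0 = -oo and K_{n+1} = +oo. *)
Definition in_gap (R : realType) (n : nat) (key : 'I_n -> R) (j : 'I_n.+1)
    (v : R) : Prop :=
  forall i : 'I_n, if (i < j)%N then key i < v else v < key i.

(* The four conditions on [alpha] and [beta] other than [key_increasing] say
   exactly that they come from a probability distribution on [queries].
   A possible query may have probability 0. *)
Record instance (R : realType) (n : nat) := MkInstance {
  key : 'I_n -> R;
  queries : set R;
  allowed : pred cmp_op;
  alpha : 'I_n.+1 -> R;
  beta : 'I_n -> R;
  key_increasing : forall i j : 'I_n, (i < j)%N -> key i < key j;
  alpha_ge0 : forall j, 0 <= alpha j;
  beta_ge0 : forall i, 0 <= beta i;
  prob_total : \sum_(j < n.+1) alpha j + \sum_(i < n) beta i = 1;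
  prob_support :
    (forall i, ~ queries (key i) -> beta i = 0) /\
    (forall j, ~ (exists2 v, queries v & in_gap key j v) -> alpha j = 0)
}.

Inductive tree (n : nat) :=
| Leaf
| Node (op : cmp_op) (i : 'I_n) (yes no : tree n).
Arguments Leaf {n}.

(* The answers met by a query whose relation to key i is [r i], from the root
   to a leaf; a path determines the leaf, and its size is the number of
   comparisons made. *)
Fixpoint route (n : nat) (r : 'I_n -> comparison) (T : tree n) : seq bool :=
  if T is Node op i yes no then
    let b := cmp_holds op (r i) in b :: route r (if b then yes else no)
  else [::].

Definition query_rel (R : realType) (n : nat) (I : instance R n) (v : R)
  : 'I_n -> comparison := fun i => compare_real v (key I i).

(* The relation to the keys shared by all the values in gap [j]. *)
Definition gap_rel (n : nat) (j : 'I_n.+1) : 'I_n -> comparison :=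
  fun i => if (i < j)%N then Gt else Lt.

Fixpoint uses_allowed (n : nat) (C : pred cmp_op) (T : tree n) : bool :=
  if T is Node op _ yes no then
    [&& C op, uses_allowed C yes & uses_allowed C no]
  else true.

Definition correct (R : realType) (n : nat) (I : instance R n) (T : tree n)
  : Prop :=
  uses_allowed (allowed I) T /\
  forall v w : R, queries I v -> queries I w ->
    route (query_rel I v) T = route (query_rel I w) T ->
    forall i : 'I_n, query_rel I v i = query_rel I w i.

(* The expected number of comparisons: all queries in the same gap follow the
   same path. *)
Definition cost (R : realType) (n : nat) (I : instance R n) (T : tree n) : R :=
  \sum_(i < n) beta I i * (size (route (query_rel I (key I i)) T))%:R
  + \sum_(j < n.+1) alpha I j * (size (route (gap_rel j) T))%:R.

(* If there is a correct tree, the infimum is attained: a cost depends only on a vector of natural path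
   lengths, with nonnegative coefficients. *)
Definition opt_cost (R : realType) (n : nat) (I : instance R n) : R :=
  inf [set cost I T | T in [set T | correct I T]].

(* Programs of a unit-cost real RAM, in structured form.  Memory consists of arrays of
   natural numbers and arrays of reals, indexed by natural numbers (a scalar
   variable is entry 0 of an array).  The real numbers can only be added,
   subtracted, multiplied, divided and compared: there is no rounding, and the
   only constants are natural numbers, so that a program, being a finite
   object independent of the input, carries no real advice.  Each assignment
   and each evaluation of a test takes one unit of time; as the expressions of
   a program have bounded size, this agrees up to a constant factor (depending
   on the program) with charging for each elementary operation. *)

Inductive nexp :=
| NConst (k : nat)
| NGet (a : nat) (e : nexp)
| NAdd (e1 e2 : nexp)
| NSub (e1 e2 : nexp)
| NHalf (e : nexp).

Inductive rexp :=
| RConst (k : nat)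
| RGet (a : nat) (e : nexp)
| RAdd (x1 x2 : rexp)
| RSub (x1 x2 : rexp)
| RMul (x1 x2 : rexp)
| RDiv (x1 x2 : rexp).

Inductive test :=
| NLe (e1 e2 : nexp)
| RLe (x1 x2 : rexp)
| TNot (b : test)
| TAnd (b1 b2 : test).

Inductive program :=
| Skip
| NSet (a : nat) (i e : nexp)
| RSet (a : nat) (i : nexp) (x : rexp)
| Seq (p1 p2 : program)
| If (b : test) (p1 p2 : program)
| While (b : test) (p : program).

Record memory (R : Type) := Memory {
  nats : nat -> nat -> nat;
  reals : nat -> nat -> R
}.

Definition upd (A : Type) (f : nat -> nat -> A) (a i : nat) (x : A)
  : nat -> nat -> A :=
  fun a' i' => if (a' == a) && (i' == i) then x else f a' i'.

Fixpoint neval (R : Type) (m : memory R) (e : nexp) : nat :=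
  match e with
  | NConst k => k
  | NGet a e => nats m a (neval m e)
  | NAdd e1 e2 => (neval m e1 + neval m e2)%N
  | NSub e1 e2 => (neval m e1 - neval m e2)%N
  | NHalf e => (neval m e)./2
  end.

Fixpoint reval (R : realType) (m : memory R) (x : rexp) : R :=
  match x with
  | RConst k => k%:R
  | RGet a e => reals m a (neval m e)
  | RAdd x1 x2 => reval m x1 + reval m x2
  | RSub x1 x2 => reval m x1 - reval m x2
  | RMul x1 x2 => reval m x1 * reval m x2
  | RDiv x1 x2 => reval m x1 / reval m x2
  end.

Fixpoint teval (R : realType) (m : memory R) (b : test) : bool :=
  match b with
  | NLe e1 e2 => (neval m e1 <= neval m e2)%N
  | RLe x1 x2 => reval m x1 <= reval m x2
  | TNot b => ~~ teval m b
  | TAnd b1 b2 => teval m b1 && teval m b2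
  end.

(* [exec p m t m']: started in memory m, program p halts in memory m' after
   t units of time. *)
Inductive exec (R : realType)
  : program -> memory R -> nat -> memory R -> Prop :=
| ExecSkip m : exec Skip m 1 m
| ExecNSet a i e m :
    exec (NSet a i e) m 1
      (Memory (upd (nats m) a (neval m i) (neval m e)) (reals m))
| ExecRSet a i x m :
    exec (RSet a i x) m 1
      (Memory (nats m) (upd (reals m) a (neval m i) (reval m x)))
| ExecSeq p1 p2 m1 m2 m3 t1 t2 :
    exec p1 m1 t1 m2 -> exec p2 m2 t2 m3 -> exec (Seq p1 p2) m1 (t1 + t2) m3
| ExecIf b p1 p2 m m' t :
    exec (if teval m b then p1 else p2) m t m' ->
    exec (If b p1 p2) m t.+1 m'
| ExecWhileTrue b p m1 m2 m3 t1 t2 :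
    teval m1 b -> exec p m1 t1 m2 -> exec (While b p) m2 t2 m3 ->
    exec (While b p) m1 (t1 + t2).+1 m3
| ExecWhileFalse b p m :
    ~~ teval m b -> exec (While b p) m 1 m.

Definition op_code (op : cmp_op) : nat :=
  match op with OpLt => 0 | OpLe => 1 | OpEq => 2 | OpGe => 3 | OpGt => 4 end.

(* [f] as an array of length [n] padded with [x0]. *)
Definition array (A : Type) (x0 : A) (n : nat) (f : 'I_n -> A) (i : nat) : A :=
  oapp f x0 (insub i).

(* The query set is presented by 2n+1 bits, telling which keys are possible
   queries and which gaps contain possible queries. *)
Definition input_nats (R : realType) (n : nat) (I : instance R n) (a : nat)
  : nat -> nat :=
  match a with
  | 0 => fun i => if i == 0 then n else 0
  | 1 => fun i =>
      has (fun op => allowed I op && (op_code op == i))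
        [:: OpLt; OpLe; OpEq; OpGe; OpGt]
  | 2 => array 0 (fun i : 'I_n => nat_of_bool `[< queries I (key I i) >])
  | 3 => array 0 (fun j : 'I_n.+1 =>
      nat_of_bool `[< exists2 v, queries I v & in_gap (key I) j v >])
  | _ => fun _ => 0
  end%N.

Definition input_reals (R : realType) (n : nat) (I : instance R n) (a : nat)
  : nat -> R :=
  match a with
  | 0%N => array 0 (key I)
  | 1%N => array 0 (beta I)
  | 2%N => array 0 (alpha I)
  | _ => fun _ => 0
  end.

Definition input (R : realType) (n : nat) (I : instance R n) : memory R :=
  Memory (input_nats I) (input_reals I).

(* In preorder; a leaf is written 0. *)
Fixpoint serialize (n : nat) (T : tree n) : seq nat :=
  if T is Node op i yes no then
    [:: (op_code op).+1, nat_of_ord i & serialize yes ++ serialize no]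
  else [:: 0%N].

Definition outputs (R : realType) (n : nat) (m : memory R) (T : tree n)
  : Prop :=
  forall k, (k < size (serialize T))%N ->
    nats m 4 k = nth 0%N (serialize T) k.

(* Main.v *)
Require Import Defs.
From mathcomp Require Import all_boot all_order all_algebra reals.
From mathcomp Require Import boolp classical_sets.
From mathcomp Require Import zify ring lra.
Import Order.TTheory GRing.Theory Num.Theory.
Set Implicit Arguments.
Unset Strict Implicit.
Unset Printing Implicit Defensive.
Local Open Scope ring_scope.

(* If some inequality is allowed, say "<", group each key with the gap above it
   (a group is what "<" cannot split), give group g an interval of length its
   probability w_g, and repeatedly split a range of groups at the middle of its
   first and last midpoints.  A leaf at depth D then satisfies w_g * 2^D <= 4,
   and one more comparison separates the key from the gap, so every class c of
   queries has depth d with p_c * 2^d <= 8.  Kraft's inequality for the depths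
   l_c in any correct tree gives sum_c p_c * (d_c - l_c) <= 3.  Each split is
   found by binary search.  If only "=" is allowed, a correct tree is
   essentially a chain of equality tests; testing the possible keys in
   decreasing order of probability, sorted with a tournament tree, is optimal
   up to 1. *)

(** * Classes of queries, Kraft's inequality *)

(** Origin of the constants: a range of at least two groups spans at least half the length of each
    of its groups, and the span after D splits is at most 2^-D. The last split above a leaf at depth
    D thus gives w <= 2 * 2^-(D-1), that is w * 2^D <= 4; the final comparison turns 4 into 8. From
    p * 2^d <= 8 and 2^x >= 1 + x at x = d - l - 3 follows p * (d - l - 2) <= 2^-l. Summed over the
    possible classes the right side is at most 1 by Kraft, and the offset 2 costs 2 because the
    probabilities add up to 1: hence 3. The obstacle is that the allowed operators and the possible
    queries are arbitrary. A key and the gap in its group need not be separable at all; that a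
    correct tree exists says that they are, by some single allowed comparison, whenever both are
    possible. Impossible classes have probability 0 and drop out of the sums. With equality alone no
    balanced tree exists, so the halving argument has no counterpart: all classes but one follow the
    [no] branch of each test, and the comparison is with the ranks 1, 2, ..., r of the most probable
    keys. *)

Lemma key_lt (R : realType) n (I : instance R n) (i j : 'I_n) :
  (key I i < key I j) = (i < j)%N.
Proof.
case: (ltngtP i j) => [/key_increasing-> //|/(key_increasing I) h|/val_inj->].
  by apply/negbTE; rewrite -leNgt ltW.
by rewrite ltxx.
Qed.

(** A query matters only through its relations to the keys, which leaves 2n+1 cases: [inl k] is key
    k itself and [inr j] is gap j. *)
Definition class n := ('I_n + 'I_n.+1)%type.

Definition class_rel n (c : class n) : 'I_n -> comparison :=
  match c with
  | inl k => fun i => if (k < i)%N then Lt else if (k == i)%N then Eq else Gt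
  | inr j => gap_rel j
  end.

Lemma class_rel_inj n : injective (@class_rel n).
Proof.
move=> [k|j] [k'|j'] /= E.
- have /= := congr1 (fun f => f k) E; rewrite ltnn eqxx.
  by have [->|] := eqVneq k' k; last case: ifP.
- have /= := congr1 (fun f => f k) E; rewrite ltnn eqxx /gap_rel.
  by case: ifP.
- have /= := congr1 (fun f => f k') E; rewrite ltnn eqxx /gap_rel.
  by case: ifP.
congr inr; apply/val_inj => /=.
have H (i : 'I_n) : (i < j)%N = (i < j')%N.
  by have /= := congr1 (fun f => f i) E; rewrite /gap_rel; do 2!case: ifP.
have := ltn_ord j; have := ltn_ord j'; rewrite !ltnS => hj' hj.
case: (ltngtP j j') => // h.
  have lt := leq_trans h hj'.
  by have := H (Ordinal lt); rewrite /= h ltnn.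
have lt := leq_trans h hj.
by have := H (Ordinal lt); rewrite /= h ltnn.
Qed.

Section Classes.
Variables (R : realType) (n : nat) (I : instance R n).

Definition possible (c : class n) : bool :=
  match c with
  | inl k => `[< queries I (key I k) >]
  | inr j => `[< exists2 v, queries I v & in_gap (key I) j v >]
  end.

Definition prob (c : class n) : R :=
  match c with inl k => beta I k | inr j => alpha I j end.

Lemma prob_ge0 c : 0 <= prob c.
Proof. by case: c => /= ?; [apply: beta_ge0|apply: alpha_ge0]. Qed.

Lemma prob_impossible c : ~~ possible c -> prob c = 0.
Proof.
by case: (prob_support I) => hb ha; case: c => /= i /asboolPn; [apply: hb|apply: ha].
Qed.

Lemma sum_classes (F : class n -> R) :
  \sum_c F c = \sum_i F (inl i) + \sum_j F (inr j).
Proof. by rewrite big_sumType. Qed.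

Lemma sum_prob : \sum_c prob c = 1.
Proof. by rewrite sum_classes addrC -[RHS](prob_total I). Qed.

Lemma query_rel_key k : query_rel I (key I k) = class_rel (inl k).
Proof.
apply/funext => i; rewrite /query_rel /compare_real /= key_lt.
have [->|ne] := eqVneq k i; first by rewrite ltnn !eqxx.
case: ltngtP => // h; first by rewrite gt_eqF ?key_lt.
by rewrite (val_inj h) eqxx in ne.
Qed.

Lemma query_rel_gap j v : in_gap (key I) j v ->
  query_rel I v = class_rel (inr j).
Proof.
move=> h; apply/funext => i; rewrite /query_rel /compare_real /= /gap_rel.
have := h i; case: ifP => _ hv; last by rewrite hv.
by rewrite ltNge (ltW hv) /= gt_eqF.
Qed.

Lemma query_class v : queries I v ->
  exists2 c, possible c & query_rel I v = class_rel c.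
Proof.
move=> qv; case: (EM (exists k, v = key I k)) => [[k e]|nk].
  by exists (inl k); [rewrite /= -e; apply/asboolP|rewrite e query_rel_key].
(* The gap of v is the least j such that v is below all keys numbered from j on. For i < j
   minimality gives some key i' >= i that is at most v, hence below v, and key i is no larger. *)
pose P j := [forall i : 'I_n, (j <= i)%N ==> (v < key I i)].
have exP : exists j, P j.
  by exists n; apply/forallP => i; apply/implyP; rewrite leqNgt ltn_ord.
case: (ex_minnP exP) => j Pj minj.
have lej : (j < n.+1)%N.
  by rewrite ltnS; apply: minj; apply/forallP => i; apply/implyP; rewrite leqNgt ltn_ord.
have g : in_gap (key I) (Ordinal lej) v.
  move=> i /=; case: ltnP => h; last by move/forallP/(_ i)/implyP/(_ h) : Pj.
  have : ~~ P i by apply/negP => /minj; rewrite leqNgt h.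
  move/forallPn => [i']; rewrite negb_imply -leNgt => /andP[ii' hi'].
  have := hi'; rewrite le_eqVlt => /orP[/eqP e|hi].
    by case: nk; exists i'.
  apply: le_lt_trans hi; rewrite leNgt key_lt -leqNgt.
  by [].
exists (inr (Ordinal lej)); last exact: query_rel_gap.
by apply/asboolP; exists v.
Qed.

Lemma possible_query c : possible c ->
  exists2 v, queries I v & query_rel I v = class_rel c.
Proof.
case: c => [k|j] /= /asboolP => [qk|[v qv g]].
  by exists (key I k) => //; apply: query_rel_key.
by exists v => //; apply: query_rel_gap.
Qed.

Definition path_of (T : tree n) (c : class n) := route (class_rel c) T.

(** Reduces correctness from arbitrary real queries to the finitely many classes; by
    [class_rel_inj], equal relations to all keys mean equal classes. *)
Lemma correctP T : correct I T <->
  uses_allowed (allowed I) T /\ {in possible &, injective (path_of T)}.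
Proof.
split=> -[hu hT]; split=> //.
  move=> c c' hc hc' e.
  have [v qv ev] := possible_query hc; have [w qw ew] := possible_query hc'.
  apply: class_rel_inj; rewrite -ev -ew; apply/funext => i.
  by apply: hT => //; rewrite ev ew.
move=> v w qv qw e i.
have [c hc ec] := query_class qv; have [c' hc' ec'] := query_class qw.
rewrite ec ec'; congr (class_rel _ i); apply: hT => //.
by rewrite /path_of -ec -ec'.
Qed.

Lemma costE T : cost I T = \sum_c prob c * (size (path_of T c))%:R.
Proof.
rewrite sum_classes /cost; congr (_ + _).
by apply: eq_bigr => i _; rewrite query_rel_key.
Qed.

(** Comparing with every correct tree bounds the infimum without exhibiting a minimiser. *)
Lemma opt_cost_ge x :
  (exists T, correct I T) -> (forall T, correct I T -> x <= cost I T) ->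
  x <= opt_cost I.
Proof.
move=> [T0 hT0] h; apply: lb_le_inf; first by exists (cost I T0), T0.
by move=> _ [T hT <-]; apply: h.
Qed.

End Classes.

Lemma route_allowed n (C : pred cmp_op) (r r' : 'I_n -> comparison) T :
  (forall op i, C op -> cmp_holds op (r i) = cmp_holds op (r' i)) ->
  uses_allowed C T -> route r T = route r' T.
Proof.
move=> h; elim: T => //= op i y IHy z IHz /and3P[hop hy hz].
by rewrite h //; case: ifP => _; [rewrite IHy|rewrite IHz].
Qed.

(** Used contrapositively: once a correct tree exists, two distinct possible classes are told apart
    by some single allowed comparison, since otherwise they would share their path in that tree. *)
Lemma separated n (R : realType) (I : instance R n) T (c c' : class n) :
  correct I T -> possible I c -> possible I c' ->
  (forall op i, allowed I op ->
    cmp_holds op (class_rel c i) = cmp_holds op (class_rel c' i)) ->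
  c = c'.
Proof.
move=> /correctP[hu hT] hc hc' h; apply: hT => //.
exact: route_allowed h hu.
Qed.

(** The set [S] is general so that a node can split it by the answer; each half meets one subtree,
    with the factor 1/2. At a leaf all paths are empty, and injectivity leaves at most one class. *)
Lemma kraft (R : realType) n (S : pred (class n)) (T : tree n) :
  {in S &, injective (path_of T)} ->
  \sum_(c | S c) (2%:R^-1 : R) ^+ size (path_of T c) <= 1.
Proof.
elim: T S => [|op i y IHy z IHz] S hS.
  rewrite (eq_bigr (fun=> 1)) // sumr_const -[leRHS]/(1%:R) ler_nat.
  by apply/card_le1_eqP => c c' hc hc'; apply: hS.
pose b c := cmp_holds op (class_rel c i).
rewrite (bigID b) /= -[leRHS](_ : 2^-1 * 1 + 2^-1 * 1 = 1); last by field.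
apply: lerD.
  rewrite (eq_bigr (fun c => 2^-1 * 2^-1 ^+ size (path_of y c))).
    rewrite -mulr_sumr ler_wpM2l ?invr_ge0 //; apply: IHy.
    move=> c c' /andP[hc bc] /andP[hc' bc'] e; apply: hS => //.
    by rewrite /path_of /= -/(b c) -/(b c') bc bc' -/(path_of y c) e.
  by move=> c /andP[_ bc]; rewrite /path_of /= -/(b c) bc exprS.
rewrite (eq_bigr (fun c => 2^-1 * 2^-1 ^+ size (path_of z c))).
  rewrite -mulr_sumr ler_wpM2l ?invr_ge0 //; apply: IHz.
  move=> c c' /andP[hc bc] /andP[hc' bc'] e; apply: hS => //.
  by rewrite /path_of /= -/(b c) -/(b c') (negbTE bc) (negbTE bc') -/(path_of z c) e.
by move=> c /andP[_ bc]; rewrite /path_of /= -/(b c) (negbTE bc) exprS.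
Qed.

(* [2 ^ x >= 1 + x] for the integer [x = d - l - 3]; this replaces logarithms
   and Gibbs' inequality. *)
Lemma excess_le (R : realType) d l :
  d%:R - l%:R - 2 <= 2 ^+ d / 8 * (2%:R^-1 : R) ^+ l.
Proof.
have [h|h] := leqP d (l + 2).
  apply: (@le_trans _ _ 0).
    by move: h; rewrite -(ler_nat R) natrD; lra.
  by rewrite mulr_ge0 ?exprn_ge0 ?invr_ge0 ?divr_ge0 ?exprn_ge0.
have -> : d = (l + 3 + (d - l - 3))%N by lia.
move: (d - l - 3)%N => e.
rewrite !exprD !natrD exprVn.
have -> : 2 ^+ l * 2 ^+ 3 * 2 ^+ e / 8 / 2 ^+ l = 2 ^+ e :> R.
  by field; rewrite expf_neq0 // pnatr_eq0.
have : ((e.+1)%:R <= (2 ^ e)%N%:R :> R) by rewrite ler_nat ltn_expl.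
by rewrite natrX -natr1; lra.
Qed.

(** By [excess_le] and the hypothesis, each term p * (d - l - 2) is at most 2^-l. Kraft bounds the
    sum by 1, and the offsets add 2 times the total probability. *)
Lemma cost_le_add3 (R : realType) n (I : instance R n) T T' :
  (forall c, prob I c * 2 ^+ size (path_of T c) <= 8) ->
  correct I T' -> cost I T <= cost I T' + 3.
Proof.
move=> hT /correctP[_ inj']; rewrite !costE.
have h : \sum_c prob I c * ((size (path_of T c))%:R - (size (path_of T' c))%:R - 2)
    <= 1.
  rewrite (bigID (possible I)) /= [X in _ + X]big1 ?addr0; last first.
    by move=> c /prob_impossible->; rewrite mul0r.
  apply: le_trans (kraft R inj'); apply: ler_sum => c _.
  have := excess_le R (size (path_of T c)) (size (path_of T' c)).
  move: (hT c); move: (size _) (size _) => d l hd he.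
  apply: le_trans (ler_wpM2l (prob_ge0 I c) he) _.
  rewrite mulrA -[leRHS]mul1r ler_wpM2r ?exprn_ge0 ?invr_ge0 //.
  by rewrite mulrA ler_pdivrMr // mul1r.
move: h; rewrite (eq_bigr (fun c => prob I c * (size (path_of T c))%:R -
  prob I c * (size (path_of T' c))%:R - 2 * prob I c)); last by move=> c _; ring.
by rewrite !sumrB -mulr_sumr sum_prob; lra.
Qed.

(** * Alphabetic trees *)

Definition inequality op := if op is OpEq then false else true.

Definition yes_below op : bool :=
  match op with OpLt | OpLe => true | _ => false end.

(* A comparison with "<" or ">=" cannot separate key k from the gap k.+1 above
   it; one with "<=" or ">" cannot separate it from the gap k below it.  The two
   classes form a group, numbered as its gap. *)
Definition delta op : nat :=
  match op with OpLt | OpGe => 1 | _ => 0 end.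

Definition group n op (c : class n) : nat :=
  match c with inl k => (k + delta op)%N | inr j => j end.

Definition key_of_group n op g : option 'I_n :=
  if (delta op <= g)%N then insub (g - delta op)%N else None.

Lemma group_le n op (c : class n) : (group op c <= n)%N.
Proof.
case: c => [k|j] /=; last by rewrite -ltnS.
by have := ltn_ord k; case: op => /=; lia.
Qed.

Lemma key_of_groupK n op (k : 'I_n) : key_of_group n op (k + delta op) = Some k.
Proof. by rewrite /key_of_group leq_addl addnK valK. Qed.

(** With groups as the unit, the four inequalities act alike: key i cuts the groups up to i from
    those after it, and only the side called [yes] depends on the operator. *)
Lemma cmp_holds_group n op (c : class n) i : inequality op ->
  cmp_holds op (class_rel c i) = (yes_below op == (group op c <= i)%N).
Proof.
case: c => [k|j] /=; last first.
  by rewrite /gap_rel; case: op => //= _; case: ltnP.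
have [->|ki] := eqVneq k i.
  by rewrite ltnn; case: op => //=; rewrite ?addn0 ?addn1 ?ltnn ?leqnn.
move: ki; rewrite -val_eqE /=.
by case: op => //= + _; rewrite ?addn0 ?addn1; case: ltngtP.
Qed.

Section Alphabetic.
Variables (R : realType) (n : nat) (I : instance R n).
Variables (ob : cmp_op) (fin : option cmp_op).

Definition base_node i (T1 T2 : tree n) : tree n :=
  if yes_below ob then Node ob i T1 T2 else Node ob i T2 T1.

(** The comparison is made for every group that has a key, even if its key or its gap is impossible;
    this level is already paid for in the depth bound. *)
Definition group_leaf g : tree n :=
  if fin is Some f then
    if key_of_group n ob g is Some k then Node f k Leaf Leaf else Leaf
  else Leaf.

(** The guard is against truncated subtraction, which would also charge key 0 to group 0 when
    [delta ob] is 1. When it is 0, the padding of [array] gives group n no key. *)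
Definition weight g : R :=
  array 0 (alpha I) g +
  (if (delta ob <= g)%N then array 0 (beta I) (g - delta ob) else 0).

(* Twice the midpoint of the interval of length [weight g] of the group g. *)
Definition midpoint g : R := (\sum_(i < g) weight i) *+ 2 + weight g.

(** A relation that records just what the binary search guarantees about a split. The alternatives
    [i = a] and [i.+1 = b] stand for the ends of the range, which the search never compares with the
    middle; the part there is a single group, of span 0. *)
Inductive built : nat -> nat -> tree n -> Prop :=
| BuiltLeaf g : built g g (group_leaf g)
| BuiltNode a b (i : 'I_n) T1 T2 :
    (a <= i < b)%N ->
    i = a :> nat \/ midpoint i *+ 2 < midpoint a + midpoint b ->
    i.+1 = b \/ midpoint a + midpoint b <= midpoint i.+1 *+ 2 ->
    built a i T1 -> built i.+1 b T2 -> built a b (base_node i T1 T2).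

Hypothesis ob_ineq : inequality ob.

Lemma path_base_node i T1 T2 c :
  path_of (base_node i T1 T2) c =
    (yes_below ob == (group ob c <= i)%N)
      :: path_of (if (group ob c <= i)%N then T1 else T2) c.
Proof.
rewrite /base_node /path_of; case E: (yes_below ob);
by rewrite /= cmp_holds_group // E; case: leqP.
Qed.

Lemma size_group_leaf g c : (size (path_of (group_leaf g) c) <= 1)%N.
Proof.
rewrite /path_of /group_leaf; case: fin => // f; case: key_of_group => //= k.
by case: ifP.
Qed.

Lemma array_ge0 m (f : 'I_m -> R) i : (forall j, 0 <= f j) -> 0 <= array 0 f i.
Proof. by rewrite /array => h; case: insub => /=. Qed.

Lemma weight_ge0 g : 0 <= weight g.
Proof.
rewrite /weight addr_ge0 ?array_ge0 //; first exact: alpha_ge0.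
by case: ifP => // _; rewrite array_ge0 //; apply: beta_ge0.
Qed.

Lemma array_ord (A : Type) m x0 (f : 'I_m -> A) (i : 'I_m) : array x0 f i = f i.
Proof. by rewrite /array valK. Qed.

Lemma array_out (A : Type) m x0 (f : 'I_m -> A) i : (m <= i)%N -> array x0 f i = x0.
Proof. by move=> h; rewrite /array insubF // ltnNge h. Qed.

Lemma prob_le_weight c : prob I c <= weight (group ob c).
Proof.
rewrite /weight; case: c => [k|j] /=.
  rewrite leq_addl addnK array_ord lerDr array_ge0 //; exact: alpha_ge0.
rewrite array_ord lerDl; case: ifP => // _; rewrite array_ge0 //; exact: beta_ge0.
Qed.

Lemma sum_weight : \sum_(g < n.+1) weight g = 1.
Proof.
rewrite big_split -[RHS](prob_total I) /=; congr (_ + _).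
  by apply: eq_bigr => j _; rewrite array_ord.
have : (delta ob <= 1)%N by case: ob.
case: (delta ob) => [|[|]] // _.
  rewrite big_ord_recr /= subn0 array_out // addr0.
  by apply: eq_bigr => j _; rewrite subn0 array_ord.
rewrite big_ord_recl /= add0r.
by apply: eq_bigr => j _; rewrite /bump /= subn1 array_ord.
Qed.

Lemma midpointS g : midpoint g.+1 = midpoint g + weight g + weight g.+1.
Proof. by rewrite /midpoint big_ord_recr /=; ring. Qed.

Lemma midpoint_span a b : (a <= b)%N ->
  midpoint a <= midpoint b.
Proof.
move=> /subnK<-; elim: (b - a)%N => [|d IH] //.
rewrite addSn midpointS; have := weight_ge0 (d + a); have := weight_ge0 (d + a).+1.
lra.
Qed.

(** Doubled midpoints of neighbouring groups differ by the sum of the two weights, and g has a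
    neighbour in the range because a < b. *)
Lemma weight_le_span a b g : (a < b)%N -> (a <= g <= b)%N ->
  weight g <= midpoint b - midpoint a.
Proof.
move=> lt_ab /andP[ag gb]; have w0 := weight_ge0.
have [h|h] := ltnP g b.
  have := midpoint_span h; have := midpoint_span ag; rewrite midpointS.
  have := w0 g.+1; lra.
have {gb h}-> : g = b by lia.
case: b lt_ab => // b; rewrite ltnS => /midpoint_span; rewrite midpointS.
have := w0 b; lra.
Qed.

Lemma span_le2 : midpoint n - midpoint 0 <= 2.
Proof.
have := sum_weight; rewrite big_ord_recr /= /midpoint big_ord0.
have := weight_ge0 0; have := weight_ge0 n; lra.
Qed.

(* Each split at least halves the span of the midpoints on both sides. *)
Lemma built_depth a b T M c :
  built a b T -> (a <= group ob c <= b)%N ->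
  weight (group ob c) <= M -> (midpoint b - midpoint a) *+ 2 <= M ->
  weight (group ob c) * 2 ^+ size (path_of T c) <= M *+ 2.
Proof.
set g := group ob c => bT; have w0 := weight_ge0 g.
elim: bT M => {a b T} [a|a b i T1 T2 /andP[ai ib] hl hr _ IH1 _ IH2] M gab hw hs.
  have : (2 ^+ size (path_of (group_leaf a) c) <= 2 :> R).
    by case: size (size_group_leaf a c) => [|[|]] //= _; rewrite ?expr0 ?expr1 ?ler1n.
  by move=> h; apply: le_trans (ler_wpM2l w0 h) _; lra.
(* A node covers at least two groups, so the weight is at most the span, which is at most M / 2; the
   split halves the span, and both hypotheses hold again with M / 2. *)
have wM : weight g <= M / 2.
  have := weight_le_span (leq_ltn_trans ai ib) gab; lra.
rewrite path_base_node /= exprS mulrCA.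
suff : weight g * 2 ^+ size (path_of (if (g <= i)%N then T1 else T2) c) <= M / 2 *+ 2 by lra.
have ms := midpoint_span (ltnW (leq_ltn_trans ai ib)).
case: ifP => gi.
  apply: IH1 => //; first by rewrite gi; case/andP: gab => ->.
  by case: hl => [->|]; lra.
apply: IH2 => //; first by rewrite ltnNge gi; case/andP: gab.
by case: hr => [->|]; lra.
Qed.

Lemma built_cost T c : built 0 n T -> prob I c * 2 ^+ size (path_of T c) <= 8.
Proof.
move=> bT; apply: (@le_trans _ _ (weight (group ob c) * 2 ^+ size (path_of T c))).
  by rewrite ler_wpM2r ?exprn_ge0 // prob_le_weight.
(* Here M = 4, twice the bound 2 on the span of doubled midpoints; the last factor 2 pays for the
   comparison in the leaf. *)
have -> : 8 = 4 *+ 2 :> R by ring.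
apply: (built_depth bT); first exact: group_le.
  have := sum_weight.
  rewrite (bigD1 (Ordinal (group_le ob c : (_ < n.+1)%N))) //=.
  have : 0 <= \sum_(i < n.+1 | i != Ordinal (group_le ob c : (_ < n.+1)%N)) weight i.
    by apply: sumr_ge0 => i _; apply: weight_ge0.
  by lra.
have := span_le2; lra.
Qed.

Hypothesis ob_allowed : allowed I ob.
Hypothesis fin_allowed : forall f, fin = Some f -> allowed I f.
Hypothesis fin_separates : forall k : 'I_n, forall j : 'I_n.+1,
  possible I (inl k) -> possible I (inr j) -> (k + delta ob)%N = j ->
  exists2 f, fin = Some f &
    cmp_holds f (class_rel (inl k) k) != cmp_holds f (class_rel (inr j) k).

Lemma built_allowed a b T : built a b T -> uses_allowed (allowed I) T.
Proof.
elim=> {a b T} [g|a b i T1 T2 _ _ _ _ h1 _ h2].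
  rewrite /group_leaf; case E: fin => [f|] //; case: key_of_group => //= k.
  by rewrite fin_allowed.
by rewrite /base_node; case: ifP => _ /=; rewrite ob_allowed h1 h2.
Qed.

Lemma built_inj a b T c c' : built a b T ->
  (a <= group ob c <= b)%N -> (a <= group ob c' <= b)%N ->
  possible I c -> possible I c' -> path_of T c = path_of T c' -> c = c'.
Proof.
move=> bT + + pc pc'.
elim: bT => {a b T} [g|a b i T1 T2 _ _ _ _ IH1 _ IH2].
  rewrite -!eqn_leq => /eqP gc /eqP gc'.
  (* Two keys, or two gaps, with the same group number coincide, so up to symmetry a key faces a
     gap. *)
  wlog [k [j [ec ec']]] : c c' pc pc' gc gc' / exists k j, c = inl k /\ c' = inr j.
    case: c c' pc pc' gc gc' => [k|j] [k'|j'] pc pc' gc gc' H e.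
    - by congr inl; apply: val_inj; move: gc gc' => /= -> /addIn.
    - by apply: (H (inl k) (inr j')) => //; exists k, j'.
    - by symmetry; apply: (H (inl k') (inr j)) => //; exists k', j.
    - by congr inr; apply: val_inj; move: gc gc' => /= -> .
  rewrite {}ec {}ec' /= in pc pc' gc gc' *.
  have [|f ef] := fin_separates pc pc'; first by rewrite -gc.
  rewrite /path_of /group_leaf ef {1 2}gc key_of_groupK => /negP ne /= [e].
  by case: ne; apply/eqP.
rewrite !path_base_node => h h' [].
case: leqP => gi; case: leqP => gi'; rewrite ?eqb_id //; try by case: yes_below.
  by move=> _ e; apply: IH1 => //; lia.
by move=> _ e; apply: IH2 => //; lia.
Qed.

Lemma built_correct T : built 0 n T -> correct I T.
Proof.
move=> bT; apply/correctP; split; first exact: built_allowed bT.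
move=> c c' pc pc'; apply: (built_inj bT) => //; exact: group_le.
Qed.

Lemma built_opt T : built 0 n T -> cost I T <= opt_cost I + 3.
Proof.
move=> bT; rewrite -lerBlDr; apply: opt_cost_ge.
  by exists T; apply: built_correct.
move=> T' /(cost_le_add3 (fun c => built_cost c bT)); lra.
Qed.

End Alphabetic.

(** * Trees with equality tests only *)

(** Abel summation as an inequality: the induction shows that the sum is at least [b m] times the
    plain sum of the x i. *)
Lemma sum_antitone_ge0 (R : realType) (b x : nat -> R) m :
  (forall r, (r < m)%N -> b r.+1 <= b r) -> 0 <= b m ->
  (forall r, (r <= m)%N -> 0 <= \sum_(i < r) x i) ->
  0 <= \sum_(i < m) b i * x i.
Proof.
move=> hb b0 hx; apply: (@le_trans _ _ (b m * \sum_(i < m) x i)).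
  by rewrite mulr_ge0 ?hx.
elim: {b0} m hb hx => [|m IH] hb hx; first by rewrite !big_ord0 mulr0.
apply: (@le_trans _ _ (b m * \sum_(i < m.+1) x i)).
  by rewrite ler_wpM2r ?hb ?hx.
rewrite !big_ord_recr /= mulrDr lerD2r; apply: IH => r h.
  exact/hb/ltnW.
exact/hx/ltnW.
Qed.

Definition eq_chain n (s : seq 'I_n) : tree n :=
  foldr (fun i T => Node OpEq i Leaf T) Leaf s.

Definition only_eq (C : pred cmp_op) := forall op, C op -> op = OpEq.

Lemma cmp_holds_eq n (c : class n) i : cmp_holds OpEq (class_rel c i) = (c == inl i).
Proof.
case: c => [k|j] /=; last by rewrite /gap_rel; case: ifP.
rewrite (inj_eq (@inl_inj _ _)).
by have [->|ki] := eqVneq k i; rewrite ?ltnn //; case: ifP.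
Qed.

Lemma path_node n op i (y z : tree n) c :
  path_of (Node op i y z) c =
    cmp_holds op (class_rel c i)
      :: path_of (if cmp_holds op (class_rel c i) then y else z) c.
Proof. by []. Qed.

Lemma path_eq_chain n (s : seq 'I_n) c :
  path_of (eq_chain s) c =
    if c is inl k then
      if k \in s then rcons (nseq (index k s) false) true
      else nseq (size s) false
    else nseq (size s) false.
Proof.
elim: s => [|i s IH]; first by case: c.
rewrite /eq_chain /= -/(eq_chain s) path_node cmp_holds_eq.
case: c IH => [k|j] IH; last by rewrite IH.
rewrite (inj_eq (@inl_inj _ _)) in_cons [i == k]eq_sym.
by have [->|ki] := eqVneq k i => //=; rewrite IH; case: ifP.
Qed.

Lemma path_neq n i k (y z : tree n) : k != i ->
  path_of (Node OpEq i y z) (inl k) = false :: path_of z (inl k).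
Proof.
by move=> ki; rewrite path_node cmp_holds_eq (inj_eq (@inl_inj _ _)) (negbTE ki).
Qed.

(** An equality test sends at most one key to [yes], so keys with distinct paths leave the [no]
    spine one at a time, and their depths plus one add up to at least 1 + 2 + ... + r. The plus one
    allows for a key that needs no test of its own at the end of the spine. *)
Lemma eq_spine (n : nat) (C : pred cmp_op) T (A : seq 'I_n) :
  only_eq C -> uses_allowed C T -> uniq A ->
  {in A &, forall k k', path_of T (inl k) = path_of T (inl k') -> k = k'} ->
  ('C((size A).+1, 2) <= \sum_(k <- A) (size (path_of T (inl k))).+1)%N.
Proof.
move=> hC; elim: T A => [|op i y IHy z IHz] A.
  move=> _ uA inj; case: A uA inj => [|k [|k' A]] //=.
    by rewrite big_seq1.
  rewrite inE => /andP[/norP[/eqP ne _] _] /(_ k k').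
  by rewrite !inE !eqxx orbT => /(_ isT isT erefl).
case/and3P => /hC-> _ hz uA inj.
have subA k : k \in rem i A -> k \in A /\ k != i.
  by rewrite mem_rem_uniq // inE => /andP[].
have IH : ('C((size (rem i A)).+1, 2) + size (rem i A) <=
    \sum_(k <- rem i A) (size (path_of (Node OpEq i y z) (inl k))).+1)%N.
  apply: (@leq_trans (\sum_(k <- rem i A) ((size (path_of z (inl k))).+1 + 1))%N).
    rewrite big_split /= sum1_size leq_add2r IHz ?rem_uniq //.
    move=> k k' /subA[hk ki] /subA[hk' ki'] e; apply: inj => //.
    by rewrite !path_neq // e.
  rewrite big_seq [leqRHS]big_seq; apply: leq_sum => k /subA[_ ki].
  by rewrite path_neq //= addn1.
have [hi|hi] := boolP (i \in A); last first.
  by move: IH; rewrite rem_id //; apply: leq_trans; apply: leq_addr.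
rewrite (perm_big _ (perm_to_rem hi)) big_cons (perm_size (perm_to_rem hi)).
rewrite [size (i :: _)]/= binS bin1 path_node [size (_ :: _)]/=.
by rewrite addnS -add1n; apply: leq_add => //; apply: IH.
Qed.

(** A gap answers [no] throughout, hence meets the whole spine, and each test there separates at
    most one key from it. *)
Lemma eq_spine_gap (n : nat) (C : pred cmp_op) T (A : seq 'I_n) j :
  only_eq C -> uses_allowed C T -> uniq A ->
  {in A, forall k, path_of T (inl k) <> path_of T (inr j)} ->
  (size A <= size (path_of T (inr j)))%N.
Proof.
move=> hC; elim: T A => [|op i y IHy z IHz] A.
  by case: A => // k A _ _ /(_ k); rewrite inE eqxx => /(_ isT).
case/and3P => /hC-> _ hz uA ne.
have gapE : path_of (Node OpEq i y z) (inr j) = false :: path_of z (inr j).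
  by rewrite path_node cmp_holds_eq.
have sizeA : (size A <= (size (rem i A)).+1)%N.
  by have [hi|hi] := boolP (i \in A); [rewrite size_rem // leqSpred|rewrite rem_id].
rewrite gapE; apply: (leq_trans sizeA); rewrite ltnS; apply: IHz => //.
  exact: rem_uniq.
move=> k; rewrite mem_rem_uniq // inE => /andP[ki hk] e.
by apply: (ne k hk); rewrite gapE path_neq // e.
Qed.

Section EqOnly.
Variables (R : realType) (n : nat) (I : instance R n) (s : seq 'I_n).
Hypothesis only : only_eq (allowed I).
Hypothesis uniq_s : uniq s.
Hypothesis mem_s : forall k, (k \in s) = possible I (inl k).
Hypothesis sorted_s : sorted (fun k k' => beta I k' <= beta I k) s.

Lemma eq_chain_correct : allowed I OpEq -> (exists T, correct I T) ->
  correct I (eq_chain s).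
Proof.
move=> heq [T0 hT0]; apply/correctP; split.
  by elim: s => //= i s' ->; rewrite heq.
have size_ne k x : k \in s ->
    rcons (nseq (index k s) false) true <> nseq x false.
  move=> _ /(congr1 (fun l => true \in l)).
  by rewrite mem_rcons in_cons eqxx !mem_nseq !andbF.
suff inj c c' : possible I c -> possible I c' ->
    path_of (eq_chain s) c = path_of (eq_chain s) c' -> c = c'.
  by move=> c c'; apply: inj.
case: c c' => [k|j] [k'|j'] hc hc'; rewrite !path_eq_chain.
- rewrite !mem_s hc hc' => /(congr1 size); rewrite !size_rcons !size_nseq => -[e].
  have hk : k \in s by rewrite mem_s.
  have hk' : k' \in s by rewrite mem_s.
  by congr inl; apply: etrans (esym (nth_index k hk)) _; rewrite e nth_index.
- by rewrite mem_s hc => /size_ne; rewrite mem_s => /(_ hc).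
- by rewrite mem_s hc' => /esym/size_ne; rewrite mem_s => /(_ hc').
(* Equality tests cannot distinguish two gaps, so the given correct tree forces all possible gaps to
   coincide. *)
move=> _; apply: (separated hT0) => // op i /only->.
by rewrite !cmp_holds_eq.
Qed.

(** The key of rank r (from 0) has depth r + 1 in the chain. In [T], depths plus one of the first r
    keys sum to at least 1 + ... + r by [eq_spine], so Abel summation against the decreasing
    probabilities applies. *)
Lemma eq_chain_le T : correct I T -> cost I (eq_chain s) <= cost I T + 1.
Proof.
move=> /correctP[hu inj]; rewrite !costE -[X in _ + X](sum_prob I) -big_split /=.
rewrite !sum_classes [leRHS](_ : _ = \sum_i beta I i * ((size (path_of T (inl i))).+1)%:R +
  \sum_j (alpha I j * (size (path_of T (inr j)))%:R + alpha I j)); last first.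
  by congr (_ + _); apply: eq_bigr => i _ /=; rewrite -?natr1 ?mulrDr ?mulr1.
apply: lerD; last first.
  apply: ler_sum => j _ /=;
  apply: (@le_trans _ _ (alpha I j * (size (path_of T (inr j)))%:R)); last first.
    by rewrite lerDl alpha_ge0.
  have [pj|/prob_impossible/= ->] := boolP (possible I (inr j)); last by rewrite !mul0r.
  rewrite ler_wpM2l ?alpha_ge0 // ler_nat path_eq_chain size_nseq.
  apply: (eq_spine_gap only hu uniq_s) => k; rewrite mem_s => pk e.
  by have := inj _ _ pk pj e.
have onlys (G : 'I_n -> nat) : \sum_i beta I i * (G i)%:R = \sum_(i <- s) beta I i * (G i)%:R.
  rewrite (bigID (mem s)) /= [X in _ + X]big1 ?addr0 ?big_uniq //.
  by move=> i; rewrite mem_s => /prob_impossible/= ->; rewrite mul0r.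
rewrite !onlys; case: s uniq_s mem_s sorted_s onlys => [|k0 s']; first by rewrite !big_nil.
rewrite -[k0 :: s']/(k0 :: s'); move: (k0 :: s') => s1 us ms ss _.
rewrite -subr_ge0 -sumrB !(big_nth k0) big_mkord.
(* Extending by 0 past the last key supplies the final value that Abel summation requires. *)
pose b r := if (r < size s1)%N then beta I (nth k0 s1 r) else 0.
pose x r : R := ((size (path_of T (inl (nth k0 s1 r)))).+1)%:R - (r.+1)%:R.
rewrite (eq_bigr (fun r : 'I__ => b r * x r)); last first.
  move=> r _; rewrite /b /x ltn_ord /= path_eq_chain mem_nth // size_rcons size_nseq index_uniq //.
  ring.
apply: sum_antitone_ge0.
- move=> r hr; rewrite /b hr; case: ifP => h; last exact: beta_ge0.
  exact: (sortedP k0 ss).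
- by rewrite /b ltnn.
move=> r hr; rewrite sumrB -!natr_sum subr_ge0 ler_nat.
have := @eq_spine n (allowed I) T (take r s1) only hu (take_uniq _ us).
have -> : (\sum_(k <- take r s1) (size (path_of T (inl k))).+1 =
  \sum_(i < r) (size (path_of T (inl (nth k0 s1 i)))).+1)%N.
  rewrite (big_nth k0) size_takel // big_mkord; apply: eq_bigr => i _.
  by rewrite nth_take.
rewrite size_takel // => h; apply: leq_trans (h _).
  by rewrite -bin2_sum big_mkord big_ord_recl /= add0n.
move=> k k' /mem_take hk /mem_take hk' e.
apply: (@inl_inj _ 'I_n.+1); apply: inj => //.
  by move: hk; rewrite ms.
by move: hk'; rewrite ms.
Qed.

Lemma eq_chain_opt : (exists T, correct I T) ->
  cost I (eq_chain s) <= opt_cost I + 3.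
Proof.
move=> ex; rewrite -lerBlDr; apply: opt_cost_ge => // T /eq_chain_le; lra.
Qed.

End EqOnly.

(** * Running time of programs *)

(** Total correctness with a time bound. The postcondition is a predicate on the final memory, so
    [runs_seq] can place the rest of a program inside it. *)
Definition runs (R : realType) p (m : memory R) (B : nat) (Q : memory R -> Prop) :=
  exists t m', [/\ exec p m t m', (t <= B)%N & Q m'].

Section Runs.
Variable R : realType.
Implicit Types (m : memory R) (Q : memory R -> Prop) (p : program).

Lemma runs_weaken p m B B' Q Q' :
  runs p m B Q -> (B <= B')%N -> (forall m', Q m' -> Q' m') -> runs p m B' Q'.
Proof.
move=> [t [m' [hx ht hQ]]] hB h; exists t, m'; split => //; last exact: h.
exact: leq_trans hB.
Qed.

Lemma runs_le B p m B' Q : runs p m B Q -> (B <= B')%N -> runs p m B' Q.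
Proof. by move=> h hB; apply: runs_weaken h hB _. Qed.

Lemma runs_skip m Q : Q m -> runs Skip m 1 Q.
Proof. by move=> h; exists 1%N, m; split=> //; constructor. Qed.

Lemma runs_nset a i e m Q :
  Q (Memory (upd (nats m) a (neval m i) (neval m e)) (reals m)) ->
  runs (NSet a i e) m 1 Q.
Proof. by move=> h; eexists 1%N, _; split; [constructor| |exact: h]. Qed.

Lemma runs_rset a i x m Q :
  Q (Memory (nats m) (upd (reals m) a (neval m i) (reval m x))) ->
  runs (RSet a i x) m 1 Q.
Proof. by move=> h; eexists 1%N, _; split; [constructor| |exact: h]. Qed.

Lemma runs_seq p1 p2 m B1 B2 Q :
  runs p1 m B1 (fun m' => runs p2 m' B2 Q) -> runs (Seq p1 p2) m (B1 + B2) Q.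
Proof.
move=> [t1 [m1 [h1 ht1 [t2 [m2 [h2 ht2 hQ]]]]]].
by exists (t1 + t2)%N, m2; split=> //; [apply: ExecSeq h1 h2|apply: leq_add].
Qed.

Lemma runs_if b p1 p2 m B Q :
  runs (if teval m b then p1 else p2) m B Q -> runs (If b p1 p2) m B.+1 Q.
Proof.
by move=> [t [m' [h ht hQ]]]; exists t.+1, m'; split=> //; constructor.
Qed.

(** The index of the invariant bounds the number of remaining iterations; each costs its body plus
    one test, and the final failing test costs 1. *)
Lemma runs_while (Inv : nat -> memory R -> Prop) b p B Q :
  (forall k m, Inv k m -> teval m b ->
     exists2 k', (k' < k)%N & runs p m B (Inv k')) ->
  (forall k m, Inv k m -> ~~ teval m b -> Q m) ->
  forall k m, Inv k m -> runs (While b p) m (k * B.+1 + 1) Q.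
Proof.
move=> hb hQ; elim/ltn_ind => k IH m hm.
case: (boolP (teval m b)) => [ht|hf]; last first.
  by exists 1%N, m; split; [constructor|lia|exact: hQ hm hf].
have [k' lt [t1 [m1 [h1 ht1 hm1]]]] := hb _ _ hm ht.
have [t2 [m2 [h2 ht2 hQ2]]] := IH _ lt _ hm1.
exists (t1 + t2).+1, m2; split=> //; first exact: ExecWhileTrue h1 h2.
nia.
Qed.

Definition frame (xs : seq nat) m m' :=
  reals m' = reals m /\ forall x, x \notin xs -> nats m' x = nats m x.

Lemma frame_refl xs m : frame xs m m. Proof. by []. Qed.

Lemma frame_trans xs m m1 m2 : frame xs m m1 -> frame xs m1 m2 -> frame xs m m2.
Proof.
by move=> [r h] [r' h']; split=> [|x hx]; [rewrite r'|rewrite h' // h].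
Qed.

Lemma frameS xs ys m m' : {subset xs <= ys} -> frame xs m m' -> frame ys m m'.
Proof.
move=> s [r h]; split=> // x hx; apply: h; apply: contra hx; exact: s.
Qed.

Lemma frame_upd xs m a i v : a \in xs ->
  frame xs m (Memory (upd (nats m) a i v) (reals m)).
Proof.
move=> ha; split=> // x hx /=; rewrite /upd; case: eqP hx => // ->.
by rewrite ha.
Qed.

End Runs.

(** * Memory layout, output buffer and stack of ranges *)

Notation var a := (NGet a (NConst 0)).
Notation assign a e := (NSet a (NConst 0) e).
Infix ";;" := Seq (at level 70, right associativity).

Notation size_ := 0%N (only parsing).
Notation ops_ := 1%N (only parsing).
Notation keys_ := 2%N (only parsing).
Notation out_ := 4%N (only parsing).
Notation base_ := 5%N (only parsing).
Notation below_ := 6%N (only parsing).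
Notation delta_ := 7%N (only parsing).
Notation fin_ := 8%N (only parsing).
Notation j_ := 9%N (only parsing).
Notation sp_ := 10%N (only parsing).
Notation a_ := 11%N (only parsing).
Notation b_ := 12%N (only parsing).
Notation lo_ := 13%N (only parsing).
Notation hi_ := 14%N (only parsing).
Notation mid_ := 15%N (only parsing).
Notation outlen_ := 16%N (only parsing).
Notation stacka_ := 17%N (only parsing).
Notation stackb_ := 18%N (only parsing).
Notation heap_ := 19%N (only parsing).
Notation k_ := 20%N (only parsing).
Notation beta_ := 1%N (only parsing).
Notation alpha_ := 2%N (only parsing).
Notation midpoint_ := 3%N (only parsing).
Notation acc_ := 4%N (only parsing).
Notation w_ := 5%N (only parsing).
Notation val_ := 6%N (only parsing).

Definition emit e :=
  NSet out_ (var outlen_) e ;;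
  assign outlen_ (NAdd (var outlen_) (NConst 1)).

Definition push e1 e2 :=
  NSet stacka_ (var sp_) e1 ;;
  NSet stackb_ (var sp_) e2 ;;
  assign sp_ (NAdd (var sp_) (NConst 1)).

Definition pop :=
  assign sp_ (NSub (var sp_) (NConst 1)) ;;
  assign a_ (NGet stacka_ (var sp_)) ;;
  assign b_ (NGet stackb_ (var sp_)).

Section Output.
Variable R : realType.
Implicit Types (m : memory R) (Q : memory R -> Prop) (pre : seq nat)
  (st : seq (nat * nat)).

Definition emitted m pre :=
  nats m outlen_ 0 = size pre /\
  forall i, (i < size pre)%N -> nats m out_ i = nth 0%N pre i.

Lemma emitted_frame xs m m' pre : frame xs m m' ->
  out_ \notin xs -> outlen_ \notin xs -> emitted m pre -> emitted m' pre.
Proof. by move=> [_ f] h1 h2; rewrite /emitted !f. Qed.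

Lemma runs_emit e m pre Q : emitted m pre ->
  (forall m', frame [:: out_; outlen_] m m' ->
     emitted m' (rcons pre (neval m e)) -> Q m') ->
  runs (emit e) m 2 Q.
Proof.
move=> [hl ho] hQ; apply: (@runs_seq _ _ _ _ 1 1); do 2!apply: runs_nset.
apply: hQ; first by apply: (@frame_trans _ _ _ (Memory _ _)); apply: frame_upd.
split=> [|i] /=; rewrite size_rcons /upd /= hl; first by rewrite addn1.
by rewrite ltnS nth_rcons; case: ltngtP => //= h _; apply: ho.
Qed.

Fixpoint stack_at (f g : nat -> nat) st : Prop :=
  if st is (a, b) :: st' then
    [/\ f (size st') = a, g (size st') = b & stack_at f g st']
  else True.

Definition stack m st :=
  nats m sp_ 0 = size st /\ stack_at (nats m stacka_) (nats m stackb_) st.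

Lemma stack_frame xs m m' st : frame xs m m' ->
  sp_ \notin xs -> stacka_ \notin xs -> stackb_ \notin xs -> stack m st -> stack m' st.
Proof. by move=> [_ f] h1 h2 h3; rewrite /stack !f. Qed.

Lemma stack_at_ext f g f' g' st :
  (forall i, (i < size st)%N -> f' i = f i /\ g' i = g i) ->
  stack_at f g st -> stack_at f' g' st.
Proof.
elim: st => //= -[a b] st IH h [fa gb hst].
have [-> ->] := h (size st) (ltnSn _); split => //.
by apply: IH hst => i hi; apply/h/ltnW.
Qed.

(** The second expression is evaluated after the first store, so it must not depend on [stacka_]. *)
Lemma runs_push e1 e2 m st Q : stack m st ->
  (forall i v, neval (Memory (upd (nats m) stacka_ i v) (reals m)) e2 = neval m e2) ->
  (forall m', frame [:: sp_; stacka_; stackb_] m m' ->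
     stack m' ((neval m e1, neval m e2) :: st) -> Q m') ->
  runs (push e1 e2) m 3 Q.
Proof.
move=> [hl hs] he hQ; apply: (@runs_seq _ _ _ _ 1 2); apply: runs_nset.
apply: (@runs_seq _ _ _ _ 1 1); do 2!apply: runs_nset.
rewrite he; apply: hQ.
  apply: (@frame_trans _ _ _ (Memory _ _)); last by apply: frame_upd.
  by apply: (@frame_trans _ _ _ (Memory _ _)); apply: frame_upd.
split=> /=; first by rewrite /upd /= hl addn1.
split; rewrite /upd /= ?hl ?eqxx //.
by apply: stack_at_ext hs => i hi; rewrite ltn_eqF.
Qed.

Lemma runs_pop m a b st Q : stack m ((a, b) :: st) ->
  (forall m', frame [:: sp_; a_; b_] m m' -> stack m' st ->
     nats m' a_ 0 = a -> nats m' b_ 0 = b -> Q m') ->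
  runs pop m 3 Q.
Proof.
move=> [hl [ha hb hs]] hQ; apply: (@runs_seq _ _ _ _ 1 2); apply: runs_nset.
apply: (@runs_seq _ _ _ _ 1 1); do 2!apply: runs_nset.
rewrite /= in hl *; apply: hQ; rewrite /stack /upd /= ?hl ?subn1 //=.
apply: (@frame_trans _ _ _ (Memory _ _)); last by apply: frame_upd.
by apply: (@frame_trans _ _ _ (Memory _ _)); apply: frame_upd.
Qed.

End Output.

(** * The program building an alphabetic tree *)

Notation succ e := (NAdd e (NConst 1)).
Notation midpoint_at a := (RGet midpoint_ (var a)).

(** [acc_] holds twice the weight of the groups before j: adding the weight of j once gives its
    doubled midpoint, adding it again gives the next value of [acc_]. *)
Definition midpoint_loop :=
  While (NLe (var j_) (var size_))
    (If (NLe (var delta_) (var j_))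
       (RSet w_ (NConst 0) (RAdd (RGet alpha_ (var j_))
          (RGet beta_ (NSub (var j_) (var delta_)))))
       (RSet w_ (NConst 0) (RGet alpha_ (var j_))) ;;
     RSet midpoint_ (var j_) (RAdd (RGet acc_ (NConst 0)) (RGet w_ (NConst 0))) ;;
     RSet acc_ (NConst 0) (RAdd (midpoint_at j_) (RGet w_ (NConst 0))) ;;
     assign j_ (succ (var j_))).

Definition search_loop :=
  While (NLe (NAdd (var lo_) (NConst 2)) (var hi_))
    (assign mid_ (NHalf (NAdd (var lo_) (var hi_))) ;;
     If (RLe (RAdd (midpoint_at a_) (midpoint_at b_))
             (RAdd (midpoint_at mid_) (midpoint_at mid_)))
       (assign hi_ (var mid_))
       (assign lo_ (var mid_))).

Definition emit_leaf :=
  If (TAnd (NLe (NConst 1) (var fin_))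
       (TAnd (NLe (var delta_) (var a_))
          (NLe (succ (var a_)) (NAdd (var size_) (var delta_)))))
    (emit (var fin_) ;; emit (NSub (var a_) (var delta_)) ;;
     emit (NConst 0) ;; emit (NConst 0))
    (emit (NConst 0)).

(** The range of the [yes] subtree is pushed last, hence treated first, as preorder demands. *)
Definition split_range :=
  assign lo_ (var a_) ;; assign hi_ (var b_) ;; search_loop ;;
  emit (var base_) ;; emit (var lo_) ;;
  If (NLe (NConst 1) (var below_))
    (push (succ (var lo_)) (var b_) ;; push (var a_) (var lo_))
    (push (var a_) (var lo_) ;; push (succ (var lo_)) (var b_)).

Definition build_loop :=
  While (NLe (NConst 1) (var sp_))
    (pop ;; If (NLe (var b_) (var a_)) emit_leaf split_range).

Definition alphabetic :=
  midpoint_loop ;; push (NConst 0) (var size_) ;; build_loop.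

Definition fin_code (fin : option cmp_op) : nat :=
  if fin is Some f then (op_code f).+1 else 0.

Section Alphabetic.
Variables (R : realType) (n : nat) (I : instance R n).
Variables (ob : cmp_op) (fin : option cmp_op).
Notation midpoint := (midpoint I ob).
Implicit Types (m : memory R) (Q : memory R -> Prop).

Definition midpoints m := forall g, (g <= n)%N -> reals m midpoint_ g = midpoint g.

Definition settings m :=
  [/\ nats m size_ 0 = n, nats m base_ 0 = (op_code ob).+1,
      nats m below_ 0 = yes_below ob, nats m delta_ 0 = delta ob
    & nats m fin_ 0 = fin_code fin].

Lemma settings_frame xs m m' : frame xs m m' ->
  all (fun x => x \notin xs) [:: size_; base_; below_; delta_; fin_] ->
  settings m -> settings m'.
Proof.
by move=> [_ f] /and5P[h1 h2 h3 h4 /andP[h5 _]] s; rewrite /settings !f.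
Qed.

Lemma runs_midpoint_loop m Q :
  nats m size_ 0 = n -> nats m delta_ 0 = delta ob -> nats m j_ 0 = 0%N ->
  reals m beta_ = array 0 (beta I) -> reals m alpha_ = array 0 (alpha I) ->
  reals m acc_ 0 = 0 ->
  (forall m', (forall x, x != j_ -> nats m' x = nats m x) -> midpoints m' -> Q m') ->
  runs midpoint_loop m (n.+1 * 6 + 1) Q.
Proof.
move=> hn hd hj hb ha hacc hQ.
pose Inv k m' := [/\ (nats m' j_ 0 + k)%N = n.+1,
  forall x, x != j_ -> nats m' x = nats m x,
  reals m' beta_ = array 0 (beta I) /\ reals m' alpha_ = array 0 (alpha I),
  reals m' acc_ 0 = (\sum_(i < nats m' j_ 0) weight I ob i) *+ 2
  & forall g, (g < nats m' j_ 0)%N -> reals m' midpoint_ g = midpoint g].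
apply: (@runs_while _ Inv); last first.
  by split=> //; rewrite hj // hacc big_ord0 mul0rn.
  move=> k m' [hk f _ _ hm]; rewrite /= -ltnNge (f 0%N) // hn => hlt.
  by apply: hQ => // g hg; apply: hm; apply: leq_ltn_trans hg hlt.
move=> k m' [hk f [hb' ha'] hac hm]; rewrite /= (f 0%N) // hn => hle.
exists k.-1; first by lia.
apply: (@runs_seq _ _ _ _ 2 3); apply: runs_if.
set p := (if _ then _ else _); set j := nats m' j_ 0 in hk hac hm hle *.
suff : runs p m' 1 (fun m'' => m'' =
    Memory (nats m') (upd (reals m') w_ 0 (weight I ob j))).
  move=> h; apply: runs_weaken h _ _ => // _ ->.
  apply: (@runs_seq _ _ _ _ 1 2); apply: runs_rset.
  apply: (@runs_seq _ _ _ _ 1 1); apply: runs_rset; apply: runs_nset.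
  split=> //=; rewrite ?/upd /= -/j.
  - by lia.
  - by move=> x hx; rewrite (negbTE hx) f.
  - by rewrite !eqxx hac addn1 big_ord_recr /=; ring.
  rewrite addn1 => g; rewrite ltnS => hg; case: eqP => [->|ne].
    by rewrite hac /midpoint.
  by apply: hm; lia.
rewrite {}/p /= (f 7%N) // hd; rewrite -/j; case: ifP => hdj; apply: runs_rset.
  by rewrite /= -/j (f 7%N) // hd ha' hb' /weight hdj.
by rewrite /= -/j ha' /weight hdj addr0.
Qed.

(** The gap hi - lo is at most 2^k with k iterations left, and rounding in the halving is harmless
    for a power of two. The search keeps lo before the middle and hi not before it, except at the
    ends of the range, and stops when they are adjacent. *)
Lemma runs_search_loop m a b L Q :
  nats m a_ 0 = a -> nats m b_ 0 = b -> nats m lo_ 0 = a -> nats m hi_ 0 = b ->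
  (a < b <= n)%N -> (b - a <= 2 ^ L)%N -> midpoints m ->
  (forall m' (i : 'I_n), frame [:: lo_; hi_; mid_] m m' -> nats m' lo_ 0 = i ->
     (a <= i < b)%N ->
     (i = a :> nat \/ midpoint i *+ 2 < midpoint a + midpoint b) ->
     (i.+1 = b \/ midpoint a + midpoint b <= midpoint i.+1 *+ 2) -> Q m') ->
  runs search_loop m (L * 4 + 1) Q.
Proof.
move=> ha hb hlo hhi /andP[ab bn] hL hm hQ.
pose Inv k m' := let l := nats m' lo_ 0%N in let h := nats m' hi_ 0%N in
  [/\ frame [:: lo_; hi_; mid_] m m', (a <= l < h)%N && (h <= b)%N, (h - l <= 2 ^ k)%N,
   l = a \/ midpoint l *+ 2 < midpoint a + midpoint b &
   h = b \/ midpoint a + midpoint b <= midpoint h *+ 2].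
apply: (@runs_while _ Inv); last first.
  by rewrite /Inv hlo hhi; split; rewrite ?leqnn ?ab //; left.
  move=> k m'; rewrite /Inv /=; set l := nats m' _ _; set h := nats m' _ _.
  move=> [f lh _ hl hh]; rewrite -ltnNge => hlt.
  have ln : (l < n)%N by lia.
  have hl1 : h = l.+1 by lia.
  apply: (hQ _ (Ordinal ln)) => //=; rewrite -?hl1 //; lia.
move=> k m'; rewrite /Inv /=; set l := nats m' _ _; set h := nats m' _ _.
move=> [f lh hk hl hh] hlt.
case: k hk => [|k] hk; first by move: hk; rewrite expn0; lia.
exists k => //.
apply: (@runs_seq _ _ _ _ 1 2); apply: runs_nset; apply: runs_if => /=.
have fa : nats m' a_ 0%N = a by rewrite f.2.
have fb : nats m' b_ 0%N = b by rewrite f.2.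
rewrite /upd /= fa fb f.1 -/l -/h; set md := ((l + h)./2)%N.
have lmd : (l < md < h)%N by rewrite /md; lia.
rewrite !hm; try lia.
rewrite -mulr2n; case: ifP => c; apply: runs_nset; rewrite /Inv /upd /= -/l -/h.
  split=> //=; last by right.
  - split=> [//|x].
    rewrite !inE !negb_or => /and3P[h1 h2 h3] /=.
    by rewrite (negbTE h2) (negbTE h3) f.2 // !inE !negb_or h1 h2.
  - lia.
  - by move: hk; rewrite expnS /md; lia.
split=> //=.
- split=> [//|x].
  rewrite !inE !negb_or => /and3P[h1 h2 h3] /=.
  by rewrite (negbTE h1) (negbTE h3) f.2 // !inE !negb_or h1 h2.
- lia.
- by move: hk; rewrite expnS /md; lia.
by right; rewrite ltNge c.
Qed.



Lemma runs_emit_leaf m pre g Q :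
  settings m -> emitted m pre -> nats m a_ 0 = g ->
  (forall m', frame [:: out_; outlen_] m m' ->
     emitted m' (pre ++ serialize (group_leaf n ob fin g)) -> Q m') ->
  runs emit_leaf m 9 Q.
Proof.
move=> [hn _ _ hd hf] he hg hQ; apply: runs_if.
rewrite /= hf hd hg hn.
have emit0 : serialize (group_leaf n ob fin g) = [:: 0%N] -> runs (emit (NConst 0)) m 8 Q.
  move=> e; apply: (@runs_le _ 2) => //.
  by apply: (runs_emit he) => m' fm /= hm; apply: hQ => //; rewrite e cats1.
rewrite /group_leaf /key_of_group in emit0 hQ.
case: fin hf emit0 hQ => [f|] hf emit0 hQ /=; last exact: emit0.
case: ifP => hc; last first.
  apply: emit0; case: ifP hc => //= le_d hc; rewrite insubF //.
  by apply/negbTE; rewrite -leqNgt; lia.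
case/andP: hc => le_d hlt; move: hQ; rewrite le_d.
have lt : (g - delta ob < n)%N by lia.
rewrite insubT /= => hQ.
apply: (@runs_seq _ _ _ _ 2 6); apply: (runs_emit he) => m1 f1 e1.
apply: (@runs_seq _ _ _ _ 2 4); apply: (runs_emit e1) => m2 f2 e2.
apply: (@runs_seq _ _ _ _ 2 2); apply: (runs_emit e2) => m3 f3 e3.
apply: (runs_emit e3) => m4 f4 e4; apply: hQ.
  exact: frame_trans f1 (frame_trans f2 (frame_trans f3 f4)).
by move: e4; rewrite /= f1.2 // f1.2 // hf hg hd -!cats1 -!catA.
Qed.

Definition split_order (i : nat) a b : seq (nat * nat) :=
  if yes_below ob then [:: (a, i); (i.+1, b)] else [:: (i.+1, b); (a, i)].

Lemma runs_split_range m pre st a b L Q :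
  settings m -> midpoints m -> emitted m pre -> stack m st ->
  nats m a_ 0 = a -> nats m b_ 0 = b -> (a < b <= n)%N -> (b - a <= 2 ^ L)%N ->
  (forall m' (i : 'I_n),
     frame [:: lo_; hi_; mid_; out_; outlen_; sp_; stacka_; stackb_] m m' ->
     (a <= i < b)%N ->
     (i = a :> nat \/ midpoint i *+ 2 < midpoint a + midpoint b) ->
     (i.+1 = b \/ midpoint a + midpoint b <= midpoint i.+1 *+ 2) ->
     emitted m' (pre ++ [:: (op_code ob).+1; nat_of_ord i]) ->
     stack m' (split_order i a b ++ st) -> Q m') ->
  runs split_range m (L * 4 + 14) Q.
Proof.
move=> hs hm he hst ha hb hab hL hQ.
apply: (@runs_le _ (1 + (1 + (L * 4 + 1 + (2 + (2 + 7)))))); last by lia.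
apply: runs_seq; apply: runs_nset; apply: runs_seq; apply: runs_nset; apply: runs_seq.
set m0 := Memory _ _.
have f0 : frame [:: lo_; hi_; mid_] m m0.
  apply: (@frame_trans _ _ _ (Memory _ _)); last by apply: frame_upd.
  exact: frame_upd.
apply: (@runs_search_loop m0 a b) => //.
move=> m1 i f1 hi abi hl hr.
have f01 := frame_trans f0 f1.
have s1 := settings_frame f01 isT hs.
apply: runs_seq; apply: (runs_emit (emitted_frame f01 isT isT he)) => m2 f2 e2.
apply: runs_seq; apply: (runs_emit e2) => m3 f3 e3.
have f23 := frame_trans f2 f3.
have f03 : frame [:: lo_; hi_; mid_; out_; outlen_] m m3.
  apply: frame_trans (frameS _ f01) (frameS _ f23) => x.
    by rewrite !inE => /or3P[] ->; rewrite ?orbT.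
  by rewrite !inE => /orP[] ->; rewrite ?orbT.
have {e3} : emitted m3 (pre ++ [:: (op_code ob).+1; nat_of_ord i]).
  by move: e3; rewrite /= f2.2 // hi; case: s1 => _ -> _ _ _; rewrite -!cats1 -catA.
have st3 := stack_frame f03 isT isT isT hst.
have s3 := settings_frame f03 isT hs.
have a3 : nats m3 a_ 0%N = a by rewrite f03.2.
have b3 : nats m3 b_ 0%N = b by rewrite f03.2.
have l3 : nats m3 lo_ 0%N = i by rewrite f23.2.
move=> e3.
have fin4 m4 m5 : frame [:: sp_; stacka_; stackb_] m3 m4 ->
    frame [:: sp_; stacka_; stackb_] m4 m5 ->
    stack m5 (split_order i a b ++ st) -> Q m5.
  move=> f4 f5 st5; have f35 := frame_trans f4 f5.
  apply: hQ hl hr _ st5 => //; last exact: emitted_frame f35 isT isT e3.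
  apply: frame_trans (frameS _ f03) (frameS _ f35) => x.
    by rewrite !inE => /or4P[|||/orP[]] ->; rewrite ?orbT.
  by rewrite !inE => /or3P[] ->; rewrite ?orbT.
apply: runs_if; rewrite /=; case: s3 => _ _ -> _ _; rewrite lt0b.
move: fin4; rewrite /split_order; case: ifP => _ fin4.
  apply: (@runs_seq _ _ _ _ 3 3); apply: (runs_push st3) => // m4 f4 st4.
  apply: (runs_push st4) => // m5 f5 st5; apply: (fin4 _ _ f4 f5).
  by move: st5; rewrite /= !f4.2 // l3 a3 b3 addn1.
apply: (@runs_seq _ _ _ _ 3 3); apply: (runs_push st3) => // m4 f4 st4.
apply: (runs_push st4) => // m5 f5 st5; apply: (fin4 _ _ f4 f5).
by move: st5; rewrite /= !f4.2 // l3 a3 b3 addn1.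
Qed.

Fixpoint builts (st : seq (nat * nat)) (Ts : seq (tree n)) : Prop :=
  match st, Ts with
  | [::], [::] => True
  | (a, b) :: st', T :: Ts' => built I ob fin a b T /\ builts st' Ts'
  | _, _ => False
  end.

(* The number of nodes and leaves of the trees for the ranges in the stack. *)
Definition work (st : seq (nat * nat)) : nat :=
  sumn [seq ((ab.2 - ab.1).*2).+1 | ab <- st].

(** Whatever trees are built for the ranges still on the stack, the output so far followed by their
    codes is the code of a tree built for the whole range. An empty stack thus yields the final
    tree. The time left is measured by [work]: each iteration emits one node or leaf. *)
Definition building (k : nat) m := exists pre st,
  [/\ emitted m pre, stack m st, work st = k, all (fun ab => ab.1 <= ab.2 <= n)%N st
    & forall Ts, builts st Ts ->
        exists2 T, built I ob fin 0 n T & serialize T = pre ++ flatten [seq serialize T | T <- Ts]].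

Lemma runs_build_loop m L k Q :
  settings m -> midpoints m -> (n <= 2 ^ L)%N -> building k m ->
  (forall m' T, built I ob fin 0 n T -> outputs m' T -> Q m') ->
  runs build_loop m (k * (L * 4 + 19) + 1) Q.
Proof.
move=> hs hm hL hk hQ.
pose written := [:: lo_; hi_; mid_; out_; outlen_; sp_; stacka_; stackb_; a_; b_].
rewrite (_ : L * 4 + 19 = (L * 4 + 18).+1)%N; last by lia.
apply: (@runs_while _ (fun k m' => frame written m m' /\ building k m')); last first.
- by split; [apply: frame_refl|].
- move=> {hk}k m' [_ [pre [st [[_ e] [hsp _] _ _ hT]]]] /=.
  rewrite hsp; case: st hT {hsp} => // hT _.
  have [T bT eT] := hT [::] Logic.I; apply: hQ bT _ => i; rewrite eT cats0; exact: e.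
move=> {hk}k m' [f [pre [st [he hst hw hall hT]]]] /=; rewrite hst.1.
case: st hst hw hall hT => // -[a b] st hst hw /= /andP[hab hall] hT _.
exists k.-1; first by rewrite -hw /work.
apply: (@runs_le _ (3 + (L * 4 + 14).+1)); last by lia.
apply: runs_seq; apply: (runs_pop hst) => m1 f1 st1 a1 b1; apply: runs_if.
have f01 : frame written m m1.
  by apply: frame_trans f (frameS _ f1) => x; rewrite !inE => /or3P[] ->; rewrite ?orbT.
have s1 := settings_frame f01 isT hs.
have hm1 : midpoints m1 by move=> g hg; rewrite f01.1 hm.
have e1 := emitted_frame f1 isT isT he.
rewrite /= a1 b1; case: leqP => hba.
  apply: (@runs_le _ 9); last by lia.
  apply: (runs_emit_leaf s1 e1 a1) => m2 f2 e2; split.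
    by apply: frame_trans f01 (frameS _ f2) => x; rewrite !inE => /orP[] ->; rewrite ?orbT.
  exists (pre ++ serialize (group_leaf n ob fin a)), st; split=> //.
  - exact: stack_frame f2 isT isT isT st1.
  - by rewrite -hw /work /= (_ : b - a = 0)%N //; lia.
  move=> Ts hTs; have [|T bT eT] := hT (group_leaf n ob fin a :: Ts).
    by split=> //; rewrite (_ : b = a); [apply: BuiltLeaf|lia].
  by exists T => //; rewrite eT /= catA.
have bn : (b <= n)%N by case/andP: hab.
apply: (@runs_split_range m1 pre st a b L) => //; first by rewrite hba.
  by apply: leq_trans hL; lia.
move=> m2 i f2 abi hl hr e2 st2; split.
  apply: frame_trans f01 (frameS _ f2) => x.
  rewrite !inE !orbA => h; do 2!(apply/orP; left); by rewrite -!orbA in h *.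
exists (pre ++ [:: (op_code ob).+1; nat_of_ord i]), (split_order i a b ++ st); split=> //.
- by rewrite -hw /work /split_order; case: ifP => _ /=; lia.
- by rewrite all_cat hall andbT /split_order; case: ifP => _ /=; lia.
rewrite /split_order; case E : (yes_below ob) => -[|T1 [|T2 Ts]] //=; try by case.
  move=> [bT1 [bT2 hTs]]; have [|T bT eT] := hT (base_node ob i T1 T2 :: Ts).
    by split=> //; apply: BuiltNode bT2.
  by exists T => //; rewrite eT /base_node E /= -!catA /=.
move=> [bT1 [bT2 hTs]]; have [|T bT eT] := hT (base_node ob i T2 T1 :: Ts).
  by split=> //; apply: BuiltNode bT1.
by exists T => //; rewrite eT /base_node E /= -!catA /=.
Qed.

End Alphabetic.

(** * The program sorting the keys *)

(* A tournament tree on the entries 0..N-1 of V: the node k has the sons 2k and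
   2k+1, the leaf of entry i is the node N+i, and t k is the entry that wins at
   node k. *)
Section Tournament.
Variables (R : realType) (N : nat).
Implicit Types (V : nat -> R) (t : nat -> nat).

(** The winner at j comes from a leaf below j. Hence an entry can win only at ancestors of its own
    leaf, and lowering its value disturbs only the path from there to the root. N need not be a
    power of two. *)
Definition descends t j := (t j < N)%N /\ exists e, iter e half (N + t j) = j.

Definition wins V t j := V (t j.*2) <= V (t j) /\ V (t j.*2.+1) <= V (t j).

Definition replay V t k : nat -> nat := fun j =>
  if j == k then if V (t k.*2.+1) <= V (t k.*2) then t k.*2 else t k.*2.+1 else t j.

Lemma leaf_winner t i : (i < N)%N -> descends t (N + i) -> t (N + i)%N = i.
Proof.
move=> hi [ht [[|e]]] /=; first by move/addnI.
move=> h; have : (iter e half (N + t (N + i)%N) <= N + t (N + i)%N)%N.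
  by elim: e {h} => //= e IH; apply: leq_trans IH; lia.
by move: h; rewrite -/(iter e half _); move: (iter e half _) => y h; lia.
Qed.

Lemma root_wins V t : (forall j, (0 < j < N)%N -> wins V t j) ->
  forall j, (0 < j < N.*2)%N -> V (t j) <= V (t 1).
Proof.
move=> h; elim/ltn_ind => j IH hj.
have [->|j1] := eqVneq j 1%N; first by [].
have hj2 : (0 < j./2 < N)%N by lia.
apply: (@le_trans _ _ (V (t j./2))); last by apply: IH; lia.
have [h1 h2] := h _ hj2.
by rewrite -[in leLHS](odd_double_half j); case: odd; rewrite ?add1n ?add0n.
Qed.

Lemma replay_descends V t k :
  descends t k.*2 -> descends t k.*2.+1 -> descends (replay V t k) k.
Proof.
by rewrite /descends /replay eqxx => -[h1 [e1 he1]] [h2 [e2 he2]]; case: ifP => _; split=> //;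
  [exists e1.+1; rewrite iterS he1 | exists e2.+1; rewrite iterS he2]; lia.
Qed.

Lemma replay_neq V t k j : j != k -> replay V t k j = t j.
Proof. by rewrite /replay => /negbTE->. Qed.

Lemma replay_wins V t k : (0 < k)%N -> wins V (replay V t k) k.
Proof.
move=> k0; rewrite /wins (@replay_neq _ _ _ k.*2) ?(@replay_neq _ _ _ k.*2.+1); try lia.
by rewrite /replay eqxx; case: ifP => h; split=> //; rewrite ltW // ltNge h.
Qed.

Lemma replay_wins_neq V t k j : (0 < k)%N -> j != k -> j != k./2 ->
  wins V t j -> wins V (replay V t k) j.
Proof. by move=> k0 h1 h2; rewrite /wins !replay_neq //; lia. Qed.

End Tournament.

Notation heap_at e := (NGet heap_ e).
Notation double e := (NAdd e e).
Notation winner := (heap_at (NConst 1)).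

Definition replay_step :=
  If (RLe (RGet val_ (heap_at (succ (double (var k_)))))
          (RGet val_ (heap_at (double (var k_)))))
    (NSet heap_ (var k_) (heap_at (double (var k_))))
    (NSet heap_ (var k_) (heap_at (succ (double (var k_))))).

Definition leaves_loop :=
  While (NLe (var j_) (var size_))
    (If (NLe (NConst 1) (NGet keys_ (var j_)))
       (RSet val_ (var j_) (RGet beta_ (var j_)))
       (RSet val_ (var j_) (RSub (RConst 0) (RConst 1))) ;;
     NSet heap_ (NAdd (succ (var size_)) (var j_)) (var j_) ;;
     assign j_ (succ (var j_))).

Definition heapify_loop :=
  While (NLe (NConst 1) (var k_))
    (replay_step ;; assign k_ (NSub (var k_) (NConst 1))).

Definition replay_loop :=
  While (NLe (NConst 1) (var k_))
    (replay_step ;; assign k_ (NHalf (var k_))).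

Definition select_loop :=
  While (RLe (RConst 0) (RGet val_ winner))
    (emit (NConst (op_code OpEq).+1) ;; emit winner ;; emit (NConst 0) ;;
     assign k_ (NHalf (NAdd (succ (var size_)) winner)) ;;
     RSet val_ winner (RSub (RConst 0) (RConst 1)) ;;
     replay_loop).

Definition select_keys :=
  leaves_loop ;; assign k_ (var size_) ;; heapify_loop ;; select_loop ;;
  emit (NConst 0).

Section Select.
Variables (R : realType) (n : nat) (I : instance R n).
Implicit Types (m : memory R) (Q : memory R -> Prop) (s : seq 'I_n).
Local Notation N := n.+1.

(** The value -1 marks impossible keys, keys already selected and the dummy entry n, which keeps the
    tournament nonempty for n = 0. Possible keys of probability 0 stay distinguishable from it, and
    a negative winner means that none is left. *)
Definition value s (i : nat) : R :=
  if insub i is Some k then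
    if possible I (inl k) && (k \notin s) then beta I k else -1
  else -1.

Definition values m s := forall i, (i < N)%N -> reals m val_ i = value s i.

Definition tournament_above m l :=
  (forall j, (l <= j < N.*2)%N -> descends N (nats m heap_) j) /\
  (forall j, (l <= j < N)%N -> (0 < j)%N -> wins (reals m val_) (nats m heap_) j).

Lemma runs_replay_step m Q :
  (forall m', frame [:: heap_] m m' ->
     nats m' heap_ = replay (reals m val_) (nats m heap_) (nats m k_ 0) -> Q m') ->
  runs replay_step m 2 Q.
Proof.
set k := nats m k_ 0; set t := replay _ _ _ => hQ.
have {}hQ : Q (Memory (upd (nats m) heap_ k (t k)) (reals m)).
  apply: hQ; first exact: frame_upd.
  by apply/funext => j; rewrite /upd /= /t; case: eqP => [->|/eqP/replay_neq->].
move: hQ; rewrite /t /replay eqxx => hQ; apply: runs_if; rewrite /= addn1 addnn -/k.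
by case: ifP hQ => _ hQ; apply: runs_nset; rewrite /= ?addn1 addnn.
Qed.

Lemma runs_leaves_loop m Q :
  nats m size_ 0 = n -> nats m j_ 0 = 0%N ->
  nats m keys_ = input_nats I keys_ -> reals m beta_ = array 0 (beta I) ->
  (forall m', (forall x, x != j_ -> x != heap_ -> nats m' x = nats m x) ->
     values m' [::] -> tournament_above m' N -> Q m') ->
  runs leaves_loop m (N * 5 + 1) Q.
Proof.
move=> hn hj hk hb hQ.
pose Inv k m' := [/\ (nats m' j_ 0 + k)%N = N,
  forall x, x != j_ -> x != heap_ -> nats m' x = nats m x,
  reals m' beta_ = array 0 (beta I),
  forall i, (i < nats m' j_ 0)%N -> reals m' val_ i = value [::] i
  & forall i, (i < nats m' j_ 0)%N -> nats m' heap_ (N + i)%N = i].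
apply: (@runs_while _ Inv); last first.
- by split=> //; rewrite hj.
- move=> k m' [hkj f _ hv hh]; rewrite /= -ltnNge (f 0%N) // hn => hlt.
  apply: hQ => // [i hi|]; first by apply: hv; lia.
  split=> j; last by lia.
  move=> hj2; have -> : j = (N + (j - N))%N by lia.
  by rewrite /descends hh; [split; [lia|exists 0%N]|lia].
move=> k m' [hkj f hb' hv hh]; rewrite /= (f 0%N) // hn => hle.
exists k.-1; first by lia.
apply: (@runs_seq _ _ _ _ 2 2); apply: runs_if.
set p := (if _ then _ else _); set j := nats m' j_ 0 in hkj hv hh hle *.
suff : runs p m' 1 (fun m'' => m'' =
    Memory (nats m') (upd (reals m') val_ j (value [::] j))).
  move=> h; apply: runs_weaken h _ _ => // _ ->.
  apply: (@runs_seq _ _ _ _ 1 1); do 2!apply: runs_nset.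
  split=> //=; rewrite ?/upd /= -/j.
  - by lia.
  - by move=> x h1 h2; rewrite (negbTE h1) (negbTE h2) (f x).
  - rewrite addn1 => i; rewrite ltnS; case: eqP => [->//|ne] hi.
    by apply: hv; lia.
  rewrite addn1 (f 0%N) // hn => i; rewrite ltnS => hi.
  by case: eqP => [|ne]; [lia|apply: hh; lia].
rewrite {}/p /= (f 2%N) // hk -/j /value /= /array.
case: insubP => [k' _ ek|_] /=; last first.
  by apply: runs_rset; rewrite /= sub0r.
rewrite andbT; case: ifP; case: asboolP => //= _ _; apply: runs_rset => /=.
  by rewrite -/j hb' -ek array_ord.
by rewrite sub0r.
Qed.

Lemma runs_heapify_loop m Q :
  nats m k_ 0 = n -> tournament_above m N ->
  (forall m', frame [:: k_; heap_] m m' -> tournament_above m' 1 -> Q m') ->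
  runs heapify_loop m (n * 4 + 1) Q.
Proof.
move=> hk ht hQ.
apply: (@runs_while _ (fun k m' => [/\ nats m' k_ 0 = k, (k <= n)%N,
  frame [:: k_; heap_] m m' & tournament_above m' k.+1])); last first.
- by split=> //; apply: frame_refl.
- move=> k m' [hk' _ f h]; rewrite /= hk' -leqNgt leqn0 => /eqP k0.
  by rewrite k0 in h; apply: hQ.
move=> k m' [hk' hkn f [hd hw]]; rewrite /= hk' => k0.
exists k.-1; first by lia.
apply: (@runs_seq _ _ _ _ 2 1); apply: runs_replay_step => m1 f1.
rewrite hk' => h1; apply: runs_nset; set m2 := Memory _ _.
have f2 : frame [:: k_] m1 m2 by apply: frame_upd.
have h2 : nats m2 heap_ = nats m1 heap_ by rewrite f2.2.
split; [|lia| |].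
- by rewrite /= /upd /= f1.2 // hk' subn1.
- apply: frame_trans f (frame_trans (frameS _ f1) (frameS _ f2)) => x;
  by rewrite !inE => /eqP->; rewrite ?orbT.
rewrite (prednK k0) /tournament_above h2 h1 f2.1 f1.1; split=> j hj.
  have [->|jk] := eqVneq j k; first by apply: replay_descends; apply: hd; lia.
  by rewrite /descends replay_neq //; apply: hd; lia.
move=> j0; have [->|jk] := eqVneq j k; first exact: replay_wins.
by apply: replay_wins_neq => //; [|apply: hw]; lia.
Qed.

(** Every node either wins against its sons or is an ancestor of the current [k_], itself included.
    Replaying moves [k_] to its parent, and at 0 no such ancestor is left among the nodes. *)
Lemma runs_replay_loop m L Q :
  (nats m k_ 0 < 2 ^ L)%N -> (nats m k_ 0 < N)%N ->
  (forall j, (1 <= j < N.*2)%N -> descends N (nats m heap_) j) ->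
  (forall j, (1 <= j < N)%N -> wins (reals m val_) (nats m heap_) j \/
     exists e, j = iter e half (nats m k_ 0)) ->
  (forall m', frame [:: k_; heap_] m m' -> tournament_above m' 1 -> Q m') ->
  runs replay_loop m (L * 4 + 1) Q.
Proof.
move=> hL hN hd hw hQ.
apply: (@runs_while _ (fun K m' => [/\ (nats m' k_ 0 < 2 ^ K)%N /\ (nats m' k_ 0 < N)%N,
  frame [:: k_; heap_] m m',
  forall j, (1 <= j < N.*2)%N -> descends N (nats m' heap_) j
  & forall j, (1 <= j < N)%N -> wins (reals m' val_) (nats m' heap_) j \/
     exists e, j = iter e half (nats m' k_ 0)])); last first.
- by split=> //; apply: frame_refl.
- move=> K m' [_ f hd' hw']; rewrite /= -leqNgt leqn0 => /eqP k0.
  apply: hQ => //; split=> // j hj _.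
  case: (hw' j hj) => // -[e]; rewrite k0.
  have -> : iter e half 0 = 0%N by elim: e => //= e ->.
  by lia.
move=> K m' [[hK hN'] f hd' hw'] /=; set k := nats m' k_ 0 in hK hN' hw' * => k0.
case: K hK => [|K] hK; first by move: hK; rewrite expn0; lia.
exists K => //.
apply: (@runs_seq _ _ _ _ 2 1); apply: runs_replay_step => m1 f1.
rewrite -/k => h1; apply: runs_nset; set m2 := Memory _ _.
have f2 : frame [:: k_] m1 m2 by apply: frame_upd.
have h2 : nats m2 heap_ = nats m1 heap_ by rewrite f2.2.
have hk2 : nats m2 k_ 0 = k./2 by rewrite /= /upd /= f1.2.
rewrite hk2 h2 h1 f2.1 f1.1; split.
- by split; move: hK; rewrite ?expnS; lia.
- apply: frame_trans f (frame_trans (frameS _ f1) (frameS _ f2)) => x;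
  by rewrite !inE => /eqP->; rewrite ?orbT.
- move=> j hj; have [->|jk] := eqVneq j k; first by apply: replay_descends; apply: hd'; lia.
  by rewrite /descends replay_neq //; apply: hd'; lia.
move=> j hj; have [->|jk] := eqVneq j k; first by left; apply: replay_wins.
have [->|jk2] := eqVneq j k./2; first by right; exists 0%N.
case: (hw' j hj) => [h|[[|e]]]; first by left; apply: replay_wins_neq.
  by move/eqP; rewrite (negbTE jk).
by rewrite iterSr => h; right; exists e.
Qed.

Definition chain_code s : seq nat := flatten [seq [:: 3%N; nat_of_ord k; 0%N] | k <- s].

Lemma serialize_eq_chain s : serialize (eq_chain s) = rcons (chain_code s) 0%N.
Proof. by elim: s => //= k s ->. Qed.

Lemma chain_code_rcons s k : chain_code (rcons s k) = chain_code s ++ [:: 3%N; nat_of_ord k; 0%N].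
Proof. by rewrite /chain_code map_rcons flatten_rcons. Qed.

(** The last clause, that selected keys dominate the remaining ones, keeps the list sorted when the
    next winner is appended. *)
Definition selected s :=
  [/\ uniq s, {in s, forall k, possible I (inl k)},
      sorted (fun k k' => beta I k' <= beta I k) s
    & forall k k', k \in s -> possible I (inl k') -> k' \notin s -> beta I k' <= beta I k].

Lemma max_winner m s k : values m s -> tournament_above m 1 ->
  possible I (inl k) -> k \notin s -> beta I k <= reals m val_ (nats m heap_ 1%N).
Proof.
move=> hv [hd hw] hp hk; have ltk : (k < N)%N by apply: ltnW; rewrite ltnS.
have := root_wins (N := N) (V := reals m val_) (t := nats m heap_) _ (j := N + k).
rewrite (leaf_winner (t := nats m heap_)) //; last by apply: hd; lia.
rewrite hv // /value valK hp hk /=; apply; last by lia.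
by move=> j hj; apply: hw; lia.
Qed.

Lemma selected_rcons s k : selected s -> possible I (inl k) -> k \notin s ->
  (forall k', possible I (inl k') -> k' \notin s -> beta I k' <= beta I k) ->
  selected (rcons s k).
Proof.
move=> [us ps ss ls] pk ks lk; split.
- by rewrite rcons_uniq ks.
- by move=> k'; rewrite mem_rcons inE => /orP[/eqP->|/ps].
- case: s ss ls {us ps lk} ks => //= k0 s ss ls ks; rewrite rcons_path ss /=.
  by apply: ls => //; apply: mem_last.
move=> k1 k2; rewrite !mem_rcons !in_cons negb_or => /orP[/eqP->|h1] p2 /andP[_ h2].
  exact: lk.
exact: ls.
Qed.

Lemma runs_select_loop m L Q :
  nats m size_ 0 = n -> (N <= 2 ^ L)%N -> emitted m [::] ->
  values m [::] -> tournament_above m 1 ->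
  (forall m' s, selected s -> (forall k, (k \in s) = possible I (inl k)) ->
     emitted m' (chain_code s) -> Q m') ->
  runs select_loop m (n * (L * 4 + 10) + 1) Q.
Proof.
move=> hn hL he hv ht hQ; rewrite (_ : L * 4 + 10 = (L * 4 + 9).+1)%N; last by lia.
apply: (@runs_while _ (fun K m' => exists s, [/\ nats m' size_ 0 = n /\ (K = n - size s)%N,
  selected s, emitted m' (chain_code s), values m' s & tournament_above m' 1])); last first.
- by exists [::]; rewrite subn0.
- move=> K m' [s [_ sel he' hv' ht']] /=; rewrite -ltNge => hneg.
  apply: (hQ _ s sel _ he') => k; have [_ ps _ _] := sel.
  case: (boolP (k \in s)) => [/ps-> //|ks]; apply/esym/negP => pk.
  have := max_winner hv' ht' pk ks; have := beta_ge0 I k; lra.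
move=> {hn he hv ht}K m1 [s [[hn hK] sel he hv ht]] /=.
set w := nats m1 heap_ 1%N => hw0.
have [ltw _] : descends N (nats m1 heap_) 1 by apply: ht.1; lia.
rewrite -/w in ltw.
have hvw := hv _ ltw; rewrite hvw /value in hw0.
case: insubP hw0 => [kw _ ekw|_]; last by lra.
case: ifP => [|_]; last by lra.
move=> /andP[pkw kws] _.
have bw : reals m1 val_ w = beta I kw by rewrite hvw /value -ekw valK pkw kws.
have sel' : selected (rcons s kw).
  apply: selected_rcons => // k' pk' ks'; rewrite -bw.
  exact: max_winner hv ht pk' ks'.
exists (n - (size s).+1)%N.
  have [us _ _ _] := sel'; have := max_card (mem (rcons s kw)).
  by rewrite (card_uniqP us) size_rcons card_ord hK => ltn; apply: ltn_sub2l.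
apply: (@runs_le _ (2 + (2 + (2 + (1 + (1 + (L * 4 + 1))))))); last by lia.
apply: runs_seq; apply: (runs_emit he) => m2 f2 e2.
apply: runs_seq; apply: (runs_emit e2) => m3 f3 e3.
apply: runs_seq; apply: (runs_emit e3) => m4 f4 e4.
have f14 := frame_trans f2 (frame_trans f3 f4).
have {e2 e3}e4 : emitted m4 (chain_code (rcons s kw)).
  move: e4; rewrite /= f2.2 // -/w -ekw chain_code_rcons -!cats1 -!catA //.
apply: runs_seq; apply: runs_nset; apply: runs_seq; apply: runs_rset.
set m5 := Memory _ _.
have hk5 : nats m5 k_ 0 = (N + w)./2.
  by rewrite /= /upd /= !f14.2 // hn addn1.
have hh5 : nats m5 heap_ = nats m1 heap_ by rewrite /= /upd /= f14.2.
have hv5 i : reals m5 val_ i = if i == w then -1 else reals m1 val_ i.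
  by rewrite /= /upd /= f14.2 // f14.1 sub0r.
have hs5 : nats m5 size_ 0 = n by rewrite /= /upd /= f14.2.
have e5 : emitted m5 (chain_code (rcons s kw)) by [].
apply: (runs_replay_loop (L := L)).
- rewrite hk5; lia.
- rewrite hk5; lia.
- by rewrite hh5; apply: ht.1.
- move=> j hj; rewrite hh5 hk5.
  (* A node won by [w] is an ancestor of its leaf, hence lies on the replayed path, which starts at
     the parent of that leaf. At the other nodes only a loser can have dropped to -1, so the winner
     stands. *)
  have [tj|tj] := eqVneq (nats m1 heap_ j) w.
    right; have [_ [e]] : descends N (nats m1 heap_) j by apply: ht.1; lia.
    rewrite tj; case: e => [|e]; first by move=> /= h; lia.
    by rewrite iterSr => <-; exists e.
  left; rewrite /wins !hv5 (negbTE tj).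
  have [h1 h2] : wins (reals m1 val_) (nats m1 heap_) j by apply: ht.2; lia.
  have b0 := beta_ge0 I kw.
  split; case: eqP => // e; [move: h1|move: h2]; rewrite e bw; lra.
move=> m6 f6 t6; exists (rcons s kw); split=> //.
- by rewrite f6.2 // size_rcons.
- exact: emitted_frame f6 isT isT e5.
move=> i hi; rewrite f6.1 hv5; have [->|iw] := eqVneq i w.
  by rewrite /value -ekw valK mem_rcons inE eqxx andbF.
rewrite hv // /value; case: insubP => // k _ ek.
by rewrite mem_rcons inE negb_or (_ : k != kw) //; rewrite -val_eqE /= ek ekw.
Qed.

Lemma runs_select_keys m L Q :
  nats m size_ 0 = n -> nats m j_ 0 = 0%N -> nats m outlen_ 0 = 0%N ->
  nats m keys_ = input_nats I keys_ -> reals m beta_ = array 0 (beta I) ->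
  (N <= 2 ^ L)%N ->
  (forall m' s, uniq s -> (forall k, (k \in s) = possible I (inl k)) ->
     sorted (fun k k' => beta I k' <= beta I k) s -> outputs m' (eq_chain s) -> Q m') ->
  runs select_keys m ((N * 5 + 1) + (1 + ((n * 4 + 1) + ((n * (L * 4 + 10) + 1) + 2)))) Q.
Proof.
move=> hn hj ho hk hb hL hQ.
apply: runs_seq; apply: runs_leaves_loop => // m1 f1 hv1 ht1.
apply: runs_seq; apply: runs_nset; set m2 := Memory _ _.
apply: runs_seq; apply: runs_heapify_loop => // [|m3 f3 ht3].
  by rewrite /= /upd /= f1.
apply: runs_seq; apply: (runs_select_loop (L := L)) => //.
- by rewrite f3.2 // /= /upd /= f1.
- by split=> //; rewrite f3.2 // /= /upd /= f1.
- by move=> i hi; rewrite f3.1 /=; apply: hv1.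
move=> m4 s [us ps ss _] hs e4; apply: (runs_emit e4) => m5 f5 [_ e5].
by apply: (hQ _ s) => // i; rewrite serialize_eq_chain; apply: e5.
Qed.

End Select.

(** * Choosing the comparisons *)

Definition with_first_allowed (l : seq cmp_op) (f : cmp_op -> program) (p : program) :=
  foldr (fun op => If (NLe (NConst 1) (NGet ops_ (NConst (op_code op)))) (f op)) p l.

Definition first_allowed (C : pred cmp_op) l := ohead (filter C l).

(** The operators with [delta] 1 are tried first, so a base operator with [delta] 0 shows that no
    operator with [delta] 1 is allowed; therefore [fin_ops] can omit these. *)
Definition base_ops := [:: OpLt; OpGe; OpLe; OpGt].
Definition fin_ops := [:: OpEq; OpLe; OpGt].

Definition approx_search_tree :=
  with_first_allowed base_ops
    (fun op =>
      assign base_ (NConst (op_code op).+1) ;;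
      assign below_ (NConst (yes_below op)) ;;
      assign delta_ (NConst (delta op)) ;;
      with_first_allowed fin_ops
        (fun f => assign fin_ (NConst (op_code f).+1)) Skip ;;
      alphabetic)
    (with_first_allowed [:: OpEq] (fun=> select_keys) Skip).

Section Main.
Variables (R : realType) (n : nat) (I : instance R n).
Implicit Types (m : memory R) (Q : memory R -> Prop).

Lemma runs_with_first_allowed m l f p B Q :
  nats m ops_ = input_nats I ops_ ->
  runs (oapp f p (first_allowed (allowed I) l)) m B Q ->
  runs (with_first_allowed l f p) m (size l + B) Q.
Proof.
move=> hm; elim: l => [|op l IH] //= h; apply: runs_if.
rewrite /= hm (_ : input_nats I 1 (op_code op) = allowed I op :> nat); last first.
  by case: {h} op => /=; rewrite ?andbF ?andbT ?orbF.
rewrite lt0b; move: h; rewrite /first_allowed /=; case: ifP => _ h /=; last exact: IH.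
by apply: runs_le h _; apply: leq_addl.
Qed.

Lemma runs_alphabetic ob fin m L Q :
  settings n ob fin m -> nats m j_ 0 = 0%N -> nats m sp_ 0 = 0%N ->
  nats m outlen_ 0 = 0%N -> reals m = input_reals I -> (n <= 2 ^ L)%N ->
  (forall m' T, built I ob fin 0 n T -> outputs m' T -> Q m') ->
  runs alphabetic m ((n.+1 * 6 + 1) + (3 + (n.*2.+1 * (L * 4 + 19) + 1))) Q.
Proof.
move=> hs hj hsp ho hr hL hQ; case: (hs) => hn _ _ hd _.
apply: runs_seq; apply: (runs_midpoint_loop (I := I) (ob := ob)); rewrite ?hr //.
move=> m1 f1 hm1.
have st1 : stack m1 [::] by split=> //; rewrite f1.
apply: runs_seq; apply: (runs_push st1) => // m2 f2 /= st2.
apply: (runs_build_loop (I := I) (ob := ob) (fin := fin)) => //.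
- by move: hs; rewrite /settings !f2.2 // !f1.
- by move=> g hg; rewrite f2.1 hm1.
exists [::], [:: (0%N, n)]; split=> //.
- by split=> //; rewrite f2.2 // f1.
- by move: st2; rewrite f1 // hn.
- by rewrite /work /= subn0 addn0.
- by rewrite /= leqnn.
by move=> [|T [|T' Ts]] //= [bT] // _; exists T; rewrite ?cats0.
Qed.

Definition fin := first_allowed (allowed I) fin_ops.

Lemma fin_allowed f : fin = Some f -> allowed I f.
Proof.
rewrite /fin /first_allowed /=; case: (boolP (allowed I OpEq)) => [h [<-] //|_].
case: (boolP (allowed I OpLe)) => [h [<-] //|_].
by case: (boolP (allowed I OpGt)) => [h [<-] //|].
Qed.

Lemma base_opP ob : first_allowed (allowed I) base_ops = Some ob ->
  [/\ allowed I ob, inequality ob &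
      delta ob = 0%N -> ~~ allowed I OpLt /\ ~~ allowed I OpGe].
Proof.
rewrite /first_allowed /=; case: (boolP (allowed I OpLt)) => [h [<-] //|hlt].
case: (boolP (allowed I OpGe)) => [h [<-] //|hge].
case: (boolP (allowed I OpLe)) => [h [<-] //|_].
by case: (boolP (allowed I OpGt)) => [h [<-] //|].
Qed.

(** By [separated], some allowed comparison splits the key from the gap. If it is an inequality, its
    [delta] differs from that of [ob]; the order of [base_ops] then forces [delta ob] to be 1 and
    the separator to be [<=] or [>], and either of these works at key k. *)
Lemma fin_separates ob (k : 'I_n) (j : 'I_n.+1) :
  first_allowed (allowed I) base_ops = Some ob -> (exists T, correct I T) ->
  possible I (inl k) -> possible I (inr j) -> (k + delta ob)%N = j ->
  exists2 f, fin = Some f &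
    cmp_holds f (class_rel (inl k) k) != cmp_holds f (class_rel (inr j) k).
Proof.
move=> /base_opP[_ _ hob] [T hT] pk pj ej.
have [eq_ok|no_eq] := boolP (allowed I OpEq).
  exists OpEq; first by rewrite /fin /first_allowed /= eq_ok.
  by rewrite !cmp_holds_eq eqxx.
have : (exists2 op, allowed I op &
    exists i, cmp_holds op (class_rel (inl k) i) != cmp_holds op (class_rel (inr j) i)).
  apply: contrapT => h; suff : inl k = inr j :> class n by [].
  apply: (separated hT pk pj) => op i hop; apply/eqP/negPn/negP => ne.
  by apply: h; exists op => //; exists i.
case=> op hop [i]; have [eop|nop] := boolP (inequality op); last first.
  by case: op nop hop => //; rewrite (negbTE no_eq).
rewrite !cmp_holds_group //= -ej => ne.
have nd : delta op <> delta ob by move=> e; rewrite e eqxx in ne.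
have d1 : delta ob = 1%N.
  have : (delta ob <= 1)%N by case: (ob).
  case E : (delta ob) => [|[|]] // _; have [h1 h2] := hob E.
  by case: op hop nd {ne eop} => //=; rewrite ?E ?(negbTE h1) ?(negbTE h2).
have sep f : f = OpLe \/ f = OpGt ->
    cmp_holds f (class_rel (inl k) k) != cmp_holds f (class_rel (inr j) k).
  move=> hf; rewrite !cmp_holds_group; try by case: hf => ->.
  by rewrite /= -ej d1; case: hf => -> /=; rewrite addn0 addn1 leqnn ltnn.
have hfin : allowed I OpLe \/ allowed I OpGt.
  by case: op hop nd eop {ne} => //= hop; rewrite d1 => nd _; by [case: nd | left | right].
rewrite /fin /first_allowed /= (negbTE no_eq).
have [le_ok|no_le] := boolP (allowed I OpLe); first by exists OpLe => //; apply: sep; left.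
case: hfin => [|gt_ok]; first by rewrite (negbTE no_le).
by rewrite gt_ok; exists OpGt => //; apply: sep; right.
Qed.

Lemma leaf_correct : (forall op, ~~ allowed I op) -> (exists T, correct I T) ->
  correct I Leaf /\ cost I Leaf <= opt_cost I + 3.
Proof.
move=> h ex; split.
  case: ex => -[//|op i y z] [/= /and3P[hop _ _] _].
  by have := h op; rewrite hop.
rewrite -lerBlDr; apply: opt_cost_ge => // T _.
rewrite !costE big1 => [|c _]; last by rewrite mulr0.
apply: (@le_trans _ _ 0); first by lra.
by apply: sumr_ge0 => c _; rewrite mulr_ge0 ?prob_ge0.
Qed.

End Main.

(* [trunc_log 2 n] is the integer part of log2 n; the "+ 1" only matters for
   n <= 1. *)
Theorem theorem2 (R : realType) :
  exists (p : program) (c : nat),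
    forall (n : nat) (I : instance R n),
      (exists T0 : tree n, correct I T0) ->
      exists (t : nat) (m : memory R) (T : tree n),
        [/\ exec p (input I) t m,
            (t <= c * (n * trunc_log 2 n + 1))%N,
            outputs m T,
            correct I T
          & cost I T <= opt_cost I + 3].
Proof.
(* A generous constant, large enough to absorb the explicit bounds [Bg] and [Be] below. *)
exists approx_search_tree, 1000%N => n I ex.
set B := (_ * _)%N.
suff [t [m [h1 h2 [T [h3 h4 h5]]]]] : runs approx_search_tree (input I) B
    (fun m => exists T, [/\ outputs m T, correct I T & cost I T <= opt_cost I + 3]).
  by exists t, m, T.
pose L := (trunc_log 2 n).+1.
(* The strict bound serves both the binary search on ranges within 0..n and the tournament with n +
   1 entries. *)
have hL : (n < 2 ^ L)%N by apply: trunc_log_ltn.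
have le_n : (n <= n * trunc_log 2 n + 1)%N.
  have [n1|n1] := leqP n 1%N; first by lia.
  by have := trunc_log_max (isT : 1 < 2)%N (n1 : 2 ^ 1 <= n)%N; nia.
have le_log : (trunc_log 2 n <= n * trunc_log 2 n + 1)%N.
  by case: (n) => [|n']; [rewrite trunc_log0|nia].
pose Bg := (size base_ops + (1 + (1 + (1 + (size fin_ops + 1 +
  ((n.+1 * 6 + 1) + (3 + (n.*2.+1 * (L * 4 + 19) + 1))))))))%N.
pose Be := (size base_ops + (size [:: OpEq] + ((n.+1 * 5 + 1) + (1 +
  ((n * 4 + 1) + ((n * (L * 4 + 10) + 1) + 2))))))%N.
have leBg : (Bg <= B)%N by rewrite /Bg /B /L /=; nia.
have leBe : (Be <= B)%N by rewrite /Be /B /L /=; nia.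
case Eob : (first_allowed (allowed I) base_ops) => [ob|].
  apply: (@runs_le _ Bg) => //; rewrite /Bg; apply: (@runs_with_first_allowed _ _ I) => //.
  have [ob_ok ob_ineq _] := base_opP Eob.
  rewrite Eob; do 3!(apply: runs_seq; apply: runs_nset).
  apply: runs_seq; apply: (@runs_with_first_allowed _ _ I) => //; rewrite -/(fin I).
  set m1 := Memory _ _.
  have hfin m2 : settings n ob (fin I) m2 ->
    (forall x, x \notin [:: base_; below_; delta_; fin_] ->
       nats m2 x = input_nats I x) ->
    reals m2 = input_reals I ->
    runs alphabetic m2 ((n.+1 * 6 + 1) + (3 + (n.*2.+1 * (L * 4 + 19) + 1)))
    (fun m => exists T, [/\ outputs m T, correct I T & cost I T <= opt_cost I + 3]).
    move=> hs f hr; apply: (@runs_alphabetic _ _ I _ _ _ L _ hs); rewrite ?f //; first exact: ltnW.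
    move=> m' T bT oT; exists T; split=> //.
      apply: (built_correct ob_ineq ob_ok (@fin_allowed _ _ I) _ bT) => k j.
      exact: fin_separates.
    apply: (built_opt ob_ineq ob_ok (@fin_allowed _ _ I) _ bT) => k j.
    exact: fin_separates.
  case Ef : (fin I) hfin => [f|] hfin /=.
    apply: runs_nset; apply: hfin => // x; rewrite !inE !negb_or => /and4P[h1 h2 h3 h4].
    by rewrite /= /upd (negbTE h1) (negbTE h2) (negbTE h3) (negbTE h4).
  apply: runs_skip; apply: hfin => // x; rewrite !inE !negb_or => /and4P[h1 h2 h3 h4].
  by rewrite /= /upd (negbTE h1) (negbTE h2) (negbTE h3).
have only : only_eq (allowed I).
  move: Eob; rewrite /first_allowed /=; do 4!(case: ifP => // ?).
  by move=> _ [] //; congruence.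
apply: (@runs_le _ Be) => //; rewrite /Be; apply: (@runs_with_first_allowed _ _ I) => //.
rewrite Eob; apply: (@runs_with_first_allowed _ _ I) => //.
rewrite /first_allowed /=; case: ifP => [eq_ok|no_eq] /=.
  apply: (runs_select_keys (I := I) (L := L)) => // m' s us ms ss os.
  exists (eq_chain s); split=> //; first exact: eq_chain_correct.
  exact: eq_chain_opt.
apply: (@runs_le _ 1%N) => //; apply: runs_skip; exists Leaf.
have [|h1 h2] := leaf_correct _ ex; last by split=> // -[].
move=> op; apply/negP => h; have e := only _ h.
by rewrite e no_eq in h.
Qed.
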